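(* There exists a constant $C>0$ such that the following is true. Let $0<\epsilon<1/2$ and let $N$ be a positive integer with $N\ge \mathrm{tower}(C\log(1/\epsilon))$. For every $A\subset[N]$, setting $\alpha=|A|/N$, there exists some positive integer $d$ such that $x,x+d,x+2d\in A$ for at least $(\alpha^3-\epsilon)N$ many integers $x$.
   Context: $[N]=\{1,\dots,N\}$. $\mathrm{tower}(m)$ denotes an exponential tower of twos of height $m$: $\mathrm{tower}(0)=1$ and $\mathrm{tower}(m+1)=2^{\mathrm{tower}(m)}$ for integers $m\ge 0$; for a real number $x\ge 0$, $\mathrm{tower}(x)$ means $\mathrm{tower}(\lfloor x\rfloor)$. $\log$ is the natural logarithm (the base is immaterial up to changing the constant). *)

(* Defs.v *)
From mathcomp Require Import all_boot all_order all_algebra finmap.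
From mathcomp Require Import reals exp.

Set Implicit Arguments.
Unset Strict Implicit.
Unset Printing Implicit Defensive.

Import Order.TTheory GRing.Theory Num.Theory.

Local Open Scope ring_scope.
Local Open Scope fset_scope.

Fixpoint tower (m : nat) : nat := if m is k.+1 then (2 ^ tower k)%N else 1%N.

(* [Num.truncn x] is the floor of [x] when [0 <= x], and [0] otherwise. *)
Definition rtower (R : realType) (x : R) : nat := tower (Num.truncn x).

(* First terms [x] of the progressions x, x + d, x + 2d contained in [A]; as
   [x] itself must be in [A], no integer [x] outside [A] is lost. *)
Definition AP3_starts (A : {fset nat}) (d : nat) : {fset nat} :=
  [fset x in A | (x + d \in A)%N && (x + 2 * d \in A)%N].

(* Main.v *)
Require Import Defs.
From mathcomp Require Import all_boot all_order all_algebra finmap.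
From mathcomp Require Import reals exp.
From mathcomp Require Import zify ring lra.

(* Let G = Z/(2N+1) and f = 1_A.  For a probability measure beta on G put
   b(beta) = sum_x (f * beta)(x)^3.  Starting from the uniform measure beta_0 on a short
   interval, suppose that no difference is popular.  Given beta, choose a measure mu living
   on the near-periods of beta and consider the progressions x, x+d, x+2d with d = v - u and
   u, v independent of law mu.  Next choose beta' living on near-periods of beta such that
   the count of these progressions is almost the same for g = f * beta' as for f.  Within a
   translate of mu any two terms of the progression are independent, so Schur's inequality
     x^3 + y^3 + z^3 + 3xyz >= x^2 y + x y^2 + y^2 z + y z^2 + x^2 z + x z^2,
   summed over the progressions, gives count(g) >= 2 b(beta) - b(beta') up to small errors.
   As the count for f is at most about (alpha^3 - eps) N, the excess b - alpha^3 N, shifted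
   by eps N / 2, at least doubles at each stage; since b <= N, this can happen only
   O(log(1/eps)) times.

   Each stage costs a bounded number of exponentials.  Almost-invariance is measured by
   translation seminorms on G, and beta', mu are tent functions of such seminorms.  That
   balls stay large is a Croot-Sisask argument: local autocorrelations of f are approximated
   by averages over n sample points, and translates of f with the same n sampled bits are
   close, so at least a 2^-(n+1) proportion of the translates are close to each other. *)

Set Implicit Arguments.
Unset Strict Implicit.
Unset Printing Implicit Defensive.

Import Order.TTheory GRing.Theory Num.Theory.

Local Open Scope ring_scope.

(** * Averages and translation seminorms *)

Section Averages.
Variables (R : realFieldType) (G : finZmodType).
Implicit Types (F mu beta : G -> R) (phi : G -> G).

Definition prob (I : finType) (mu : I -> R) :=
  (forall t, 0 <= mu t) /\ \sum_t mu t = 1.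

(** In use [phi] is [id] or doubling: the gaps d and 2d inside a progression call for averages over
    [mu] and over its image under doubling. *)
Definition smooth phi mu F (x : G) := \sum_t mu t * F (x + phi t).

(** The L1 distance between [mu] and its translate by [s]; a small value makes [s] a near-period of
    [mu]. *)
Definition shiftvar mu (s : G) := \sum_t `|mu (t + s) - mu t|.

Definition seminorm (rho : G -> R) :=
  [/\ forall s, 0 <= rho s, forall s, rho (- s) = rho s
    & forall s t, rho (s + t) <= rho s + rho t].

Definition energy F := \sum_x F x ^+ 3.

Lemma sum_shift F (s : G) : \sum_x F (x + s) = \sum_x F x.
Proof. by rewrite [RHS](reindex_inj (addIr s)). Qed.

Lemma sum_opp F : \sum_x F (- x) = \sum_x F x.
Proof. by rewrite [RHS](reindex_inj oppr_inj). Qed.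

Lemma seminorm_shiftvar mu : seminorm (shiftvar mu).
Proof.
split=> [s|s|s t]; first exact: sumr_ge0.
  rewrite /shiftvar -(sum_shift _ s); apply: eq_bigr => t _.
  by rewrite addrK distrC.
rewrite /shiftvar -[X in _ <= X + _](sum_shift _ t) -big_split /=.
apply: ler_sum => x _; apply: le_trans (ler_normD _ _).
by rewrite addrA [x + s + t]addrAC subrKA.
Qed.

Lemma seminormB rho s t : seminorm rho -> rho (s - t) <= rho s + rho t.
Proof. by case=> _ rN rD; rewrite -(rN t). Qed.

Lemma seminorm_lip rho s t : seminorm rho -> `|rho (s + t) - rho s| <= rho t.
Proof.
move=> sn; have [_ rN rD] := sn; rewrite ler_norml; apply/andP; split.
  have := seminormB (s + t) t sn; rewrite addrK; lra.
have := rD s t; lra.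
Qed.

Lemma seminormD rho sigma :
  seminorm rho -> seminorm sigma -> seminorm (fun s => rho s + sigma s).
Proof.
move=> [r0 rN rD] [s0 sN sD]; split=> [x|x|x y].
- by rewrite addr_ge0.
- by rewrite rN sN.
- have := rD x y; have := sD x y; lra.
Qed.

Section Prob.
Variables (I : finType) (mu : I -> R).
Hypothesis pmu : prob mu.

Lemma prob_cst (c : R) : \sum_t mu t * c = c.
Proof. by rewrite -mulr_suml pmu.2 mul1r. Qed.

Lemma prob_le (F H : I -> R) :
  (forall t, mu t != 0 -> F t <= H t) -> \sum_t mu t * F t <= \sum_t mu t * H t.
Proof.
move=> FH; apply: ler_sum => t _; have [->|n0] := eqVneq (mu t) 0.
  by rewrite !mul0r.
by rewrite ler_wpM2l ?pmu.1 // FH.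
Qed.

Lemma prob_le_cst (F : I -> R) c :
  (forall t, mu t != 0 -> F t <= c) -> \sum_t mu t * F t <= c.
Proof. by move=> Fc; rewrite -[leRHS]prob_cst; apply: prob_le. Qed.

Lemma prob_norm_le (F : I -> R) :
  `|\sum_t mu t * F t| <= \sum_t mu t * `|F t|.
Proof.
apply: le_trans (ler_norm_sum _ _ _) _; apply: ler_sum => t _.
by rewrite normrM (ger0_norm (pmu.1 t)).
Qed.

Lemma prob_sqr (F : I -> R) :
  (\sum_t mu t * F t) ^+ 2 <= \sum_t mu t * F t ^+ 2.
Proof.
set a := \sum_t _.
have : \sum_t mu t * (a * F t *+ 2 - a ^+ 2) <= \sum_t mu t * F t ^+ 2.
  apply: prob_le => t _; have := sqr_ge0 (F t - a); lra.
suff -> : \sum_t mu t * (a * F t *+ 2 - a ^+ 2) = a ^+ 2 by [].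
rewrite (eq_bigr (fun t => (a *+ 2) * (mu t * F t) - mu t * a ^+ 2)); last first.
  by move=> t _; ring.
by rewrite sumrB prob_cst -mulr_sumr -/a; ring.
Qed.

(** Jensen by the tangent at the mean a: y^3 - 3a^2 y + 2a^3 = (y - a)^2 (y + 2a), which is
    nonnegative for y, a >= 0. *)
Lemma prob_cube (F : I -> R) : (forall t, 0 <= F t) ->
  (\sum_t mu t * F t) ^+ 3 <= \sum_t mu t * F t ^+ 3.
Proof.
move=> F0; set a := \sum_t _.
have a0 : 0 <= a by apply: sumr_ge0 => t _; rewrite mulr_ge0 ?pmu.1.
have : \sum_t mu t * (a ^+ 2 * F t *+ 3 - a ^+ 3 *+ 2) <= \sum_t mu t * F t ^+ 3.
  apply: prob_le => t _; rewrite -subr_ge0.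
  have -> : F t ^+ 3 - (a ^+ 2 * F t *+ 3 - a ^+ 3 *+ 2)
            = (F t - a) ^+ 2 * (F t + a *+ 2) by ring.
  by rewrite mulr_ge0 ?sqr_ge0 ?addr_ge0 ?mulrn_wge0.
suff -> : \sum_t mu t * (a ^+ 2 * F t *+ 3 - a ^+ 3 *+ 2) = a ^+ 3 by [].
rewrite (eq_bigr (fun t => (a ^+ 2 *+ 3) * (mu t * F t) - mu t * (a ^+ 3 *+ 2))).
  by rewrite sumrB prob_cst -mulr_sumr -/a; ring.
by move=> t _; ring.
Qed.

End Prob.

Lemma smooth_ge0 phi mu F : prob mu -> (forall x, 0 <= F x) ->
  forall x, 0 <= smooth phi mu F x.
Proof. by move=> p F0 x; apply: sumr_ge0 => t _; rewrite mulr_ge0 ?p.1. Qed.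

Lemma smooth_le1 phi mu F : prob mu -> (forall x, F x <= 1) ->
  forall x, smooth phi mu F x <= 1.
Proof. by move=> p F1 x; apply: prob_le_cst. Qed.

Lemma energy_smooth phi mu F : prob mu -> (forall x, 0 <= F x) ->
  energy (smooth phi mu F) <= energy F.
Proof.
move=> p F0; rewrite /energy.
apply: (@le_trans _ _ (\sum_x \sum_t mu t * F (x + phi t) ^+ 3)).
  by apply: ler_sum => x _; apply: prob_cube.
rewrite exchange_big /= (eq_bigr (fun t => mu t * energy F)) ?prob_cst //.
by move=> t _; rewrite -mulr_sumr (sum_shift (fun x => F x ^+ 3)).
Qed.

Lemma smoothC phi psi mu beta F x :
  smooth phi mu (smooth psi beta F) x = smooth psi beta (smooth phi mu F) x.
Proof.
rewrite /smooth; under eq_bigr do rewrite mulr_sumr.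
rewrite exchange_big /=; apply: eq_bigr => t _; rewrite mulr_sumr.
by apply: eq_bigr => s _; rewrite mulrCA addrAC.
Qed.

(** A change of variable moves the translation by [y] from [F] onto [mu]. *)
Lemma smooth_lip mu F (x y : G) : (forall x, `|F x| <= 1) ->
  `|smooth id mu F (x + y) - smooth id mu F x| <= shiftvar mu y.
Proof.
move=> F1; have [_ vN _] := seminorm_shiftvar mu; rewrite -vN /smooth.
rewrite -(sum_shift (fun t => _ * F (x + y + t)) (- y)) -sumrB.
apply: le_trans (ler_norm_sum _ _ _) _; apply: ler_sum => t _.
have -> : x + y + (t - y) = x + t by rewrite -addrA [y + _]addrC subrK.
by rewrite -mulrBl normrM ler_piMr.
Qed.

Lemma smooth_near phi mu F rho d x : prob mu ->
    (forall x y, `|F (x + y) - F x| <= rho y) ->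
    (forall t, mu t != 0 -> rho (phi t) <= d) ->
  `|smooth phi mu F x - F x| <= d.
Proof.
move=> p FL sd; rewrite -(prob_cst p (F x)) /smooth -sumrB.
under eq_bigr do rewrite -mulrBr.
apply: le_trans (prob_norm_le p _) _; apply: (prob_le_cst p) => t /sd.
exact: le_trans (FL _ _).
Qed.

(** The cube has derivative at most 3 on [0, 1]. *)
Lemma energy_near F H d : (forall x, 0 <= F x <= 1) -> (forall x, 0 <= H x <= 1) ->
  (forall x, `|F x - H x| <= d) -> energy H <= energy F + d *+ 3 * #|G|%:R.
Proof.
move=> F01 H01 FH; rewrite mulr_natr -sumr_const -big_split /=.
apply: ler_sum => x _; have /andP[F0 F1] := F01 x; have /andP[H0 H1] := H01 x.
have := FH x; rewrite ler_norml => /andP[h1 h2].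
have d0 : 0 <= d by lra.
have [HF|FHx] := lerP (H x) (F x).
  have := @lerXn2r _ 3 (H x) (F x); rewrite !nnegrE => /(_ H0 F0 HF) h; lra.
rewrite -lerBlDl (_ : H x ^+ 3 - F x ^+ 3
  = (H x - F x) * (H x ^+ 2 + H x * F x + F x ^+ 2)); last by ring.
rewrite -[leRHS]mulr_natr; apply: ler_pM; nra.
Qed.

End Averages.

(** * Schur's inequality and tent functions *)

Section Schur.
Variables (R : realFieldType) (G : finZmodType).
Implicit Types (F g mu beta : G -> R) (phi : G -> G).

Definition dbl (t : G) : G := t + t.

Lemma dblB u v : dbl (v - u) = dbl v - dbl u.
Proof. by rewrite /dbl opprD addrACA. Qed.

Lemma addr_cancel (x r q : G) : x + r + (q - r) = x + q.
Proof. by rewrite [q - r]addrC addrA addrK. Qed.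

(* The law of the common difference [v - u] is that of a difference of two independent
   samples of [mu]: this makes [x] and [x + d] independent within a translate of [mu]. *)
Definition ap_form mu (f1 f2 f3 : G -> R) :=
  \sum_x \sum_u \sum_v
    mu u * mu v * (f1 x * f2 (x + (v - u)) * f3 (x + dbl (v - u))).

Lemma sum3_shift mu (K : G -> G -> G -> R) (w : G -> G -> G) :
  \sum_x \sum_u \sum_v mu u * mu v * K (x + w u v) u v
  = \sum_x \sum_u \sum_v mu u * mu v * K x u v.
Proof.
rewrite exchange_big [RHS]exchange_big /=; apply: eq_bigr => u _.
rewrite exchange_big [RHS]exchange_big /=; apply: eq_bigr => v _.
exact: (sum_shift (fun x => mu u * mu v * K x u v)).
Qed.

Lemma sum3_sym mu (K : G -> G -> G -> R) :
  \sum_x \sum_u \sum_v mu u * mu v * K x v u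
  = \sum_x \sum_u \sum_v mu u * mu v * K x u v.
Proof.
apply: eq_bigr => x _; rewrite exchange_big; apply: eq_bigr => u _.
by apply: eq_bigr => v _; rewrite (mulrC (mu v)).
Qed.

Lemma sum3_cst mu F : prob mu ->
  \sum_x \sum_u \sum_v mu u * mu v * F x = \sum_x F x.
Proof.
move=> p; apply: eq_bigr => x _; rewrite -[RHS](prob_cst p); apply: eq_bigr => u _.
by under eq_bigr do rewrite -mulrA; rewrite -mulr_sumr prob_cst.
Qed.

(** The cube of a mean is the mean times its square, and the square is at most the mean of squares.
    Independence of [u] and [v] turns the product of the two means into the double sum. *)
Lemma pair_energy phi mu g : prob mu -> (forall x, 0 <= g x) ->
  energy (smooth phi mu g)
  <= \sum_x \sum_u \sum_v mu u * mu v * (g (x + phi u) ^+ 2 * g (x + phi v)).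
Proof.
move=> p g0; apply: ler_sum => x _.
have -> : \sum_u \sum_v mu u * mu v * (g (x + phi u) ^+ 2 * g (x + phi v))
          = (\sum_u mu u * g (x + phi u) ^+ 2) * smooth phi mu g x.
  rewrite mulr_suml; apply: eq_bigr => u _; rewrite mulr_sumr.
  by apply: eq_bigr => v _; ring.
rewrite exprSr ler_wpM2r ?smooth_ge0 //; exact: prob_sqr.
Qed.

(** In sorted order the difference of the two sides is (z - y)^2 (z + y - x) + x (y - x)(z - x). *)
Lemma schur_sorted (x y z : R) : 0 <= x -> x <= y -> y <= z ->
  x ^+ 2 * y + y ^+ 2 * x + (y ^+ 2 * z + z ^+ 2 * y) + (x ^+ 2 * z + z ^+ 2 * x)
  <= x ^+ 3 + y ^+ 3 + z ^+ 3 + x * y * z *+ 3.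
Proof.
move=> x0 xy yz; rewrite -subr_ge0.
have -> : x ^+ 3 + y ^+ 3 + z ^+ 3 + x * y * z *+ 3 -
  (x ^+ 2 * y + y ^+ 2 * x + (y ^+ 2 * z + z ^+ 2 * y) + (x ^+ 2 * z + z ^+ 2 * x))
  = (z - y) ^+ 2 * (z + y - x) + x * ((y - x) * (z - x)) by ring.
by rewrite addr_ge0 // mulr_ge0 ?sqr_ge0 ?mulr_ge0 //; lra.
Qed.

Lemma schur (x y z : R) : 0 <= x -> 0 <= y -> 0 <= z ->
  x ^+ 2 * y + y ^+ 2 * x + (y ^+ 2 * z + z ^+ 2 * y) + (x ^+ 2 * z + z ^+ 2 * x)
  <= x ^+ 3 + y ^+ 3 + z ^+ 3 + x * y * z *+ 3.
Proof.
move=> x0 y0 z0.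
have [xy|/ltW yx] := lerP x y; have [yz|/ltW zy] := lerP y z;
  have [xz|/ltW zx] := lerP x z.
- exact: schur_sorted.
- by have := schur_sorted x0 xy yz; lra.
- by have := schur_sorted x0 xz zy; lra.
- by have := schur_sorted z0 zx xy; lra.
- by have := schur_sorted y0 yx xz; lra.
- by have := schur_sorted y0 yz zx; lra.
- by have := schur_sorted z0 zy yx; lra.
- by have := schur_sorted z0 zy yx; lra.
Qed.

(** Schur's inequality is summed over progressions. Translating x turns two adjacent terms into x +
    u, x + v and the two outer terms into x + 2u, x + 2v. By [pair_energy] four of the six mixed
    sums then dominate the first energy and two dominate the second. *)
Lemma ap_form_schur mu g : prob mu -> (forall x, 0 <= g x) ->
  energy (smooth id mu g) *+ 4 + energy (smooth dbl mu g) *+ 2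
  <= ap_form mu g g g *+ 3 + energy g *+ 3.
Proof.
move=> p g0.
pose E (K : G -> G -> G -> R) := \sum_x \sum_u \sum_v mu u * mu v * K x u v.
have ED K1 K2 : E (fun x u v => K1 x u v + K2 x u v) = E K1 + E K2.
  rewrite /E -big_split; apply: eq_bigr => x _; rewrite -big_split.
  apply: eq_bigr => u _; rewrite -big_split; apply: eq_bigr => v _ /=; ring.
have Ele K1 K2 : (forall x u v, K1 x u v <= K2 x u v) -> E K1 <= E K2.
  move=> le12; do 3!apply: ler_sum => ? _; rewrite ler_wpM2l // mulr_ge0 //; exact: p.1.
have shift w K : E (fun x u v => K (x + w u v) u v) = E K by exact: sum3_shift.
have sym K : E (fun x u v => K x v u) = E K by exact: sum3_sym.
pose a (x u v : G) := g x; pose b (x u v : G) := g (x + (v - u)).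
pose c (x u v : G) := g (x + dbl (v - u)).
have cst : E (fun x u v => a x u v ^+ 3) = energy g.
  exact: (@sum3_cst mu (fun x => g x ^+ 3) p).
have bst : E (fun x u v => b x u v ^+ 3) = energy g.
  by rewrite -cst -[RHS](shift (fun u v => v - u)).
have dst : E (fun x u v => c x u v ^+ 3) = energy g.
  by rewrite -cst -[RHS](shift (fun u v => dbl (v - u))).
have e1 := pair_energy id p g0; rewrite -/(E _) in e1.
have e2 := pair_energy dbl p g0; rewrite -/(E _) in e2.
have K1 : E (fun x u v => a x u v ^+ 2 * b x u v)
    = E (fun x u v => g (x + id u) ^+ 2 * g (x + id v)).
  rewrite -(shift (fun u v => u)); do 3!apply: eq_bigr => ? _.
  by rewrite /a /b addr_cancel.
have K2 : E (fun x u v => b x u v ^+ 2 * a x u v)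
    = E (fun x u v => g (x + id u) ^+ 2 * g (x + id v)).
  rewrite -(shift (fun u v => u)) -[RHS]sym; do 3!apply: eq_bigr => ? _.
  by rewrite /a /b addr_cancel.
have K3 : E (fun x u v => b x u v ^+ 2 * c x u v)
    = E (fun x u v => a x u v ^+ 2 * b x u v).
  rewrite -[RHS](shift (fun u v => v - u)).
  apply: eq_bigr => x _; apply: eq_bigr => u _; apply: eq_bigr => v _.
  by rewrite /c /dbl (addrA x).
have K4 : E (fun x u v => c x u v ^+ 2 * b x u v)
    = E (fun x u v => b x u v ^+ 2 * a x u v).
  rewrite -[RHS](shift (fun u v => v - u)).
  apply: eq_bigr => x _; apply: eq_bigr => u _; apply: eq_bigr => v _.
  by rewrite /c /dbl (addrA x).
have K5 : E (fun x u v => a x u v ^+ 2 * c x u v)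
    = E (fun x u v => g (x + dbl u) ^+ 2 * g (x + dbl v)).
  rewrite -(shift (fun u v => dbl u)); do 3!apply: eq_bigr => ? _.
  by rewrite /a /c dblB addr_cancel.
have K6 : E (fun x u v => c x u v ^+ 2 * a x u v)
    = E (fun x u v => g (x + dbl u) ^+ 2 * g (x + dbl v)).
  rewrite -(shift (fun u v => dbl u)) -[RHS]sym; do 3!apply: eq_bigr => ? _.
  by rewrite /a /c dblB addr_cancel.
have abc : E (fun x u v => a x u v * b x u v * c x u v) = ap_form mu g g g by [].
have : E (fun x u v =>
    a x u v ^+ 2 * b x u v + b x u v ^+ 2 * a x u v
    + (b x u v ^+ 2 * c x u v + c x u v ^+ 2 * b x u v)
    + (a x u v ^+ 2 * c x u v + c x u v ^+ 2 * a x u v))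
  <= E (fun x u v => a x u v ^+ 3 + b x u v ^+ 3 + c x u v ^+ 3
    + (a x u v * b x u v * c x u v
       + (a x u v * b x u v * c x u v + a x u v * b x u v * c x u v))).
  by apply: Ele => x u v; have := schur (g0 x) (g0 (x + (v - u))) (g0 (x + dbl (v - u)));
    rewrite -/(a x u v) -/(b x u v) -/(c x u v); lra.
rewrite !ED abc cst bst dst K4 K3 K2 K1 K6 K5; lra.
Qed.

End Schur.

(** * Tent measures of translation seminorms *)

Section Tent.
Variables (R : realFieldType) (G : finZmodType).

(** The ball of radius 1/m, written without division. *)
Definition ball (rho : G -> R) (m : nat) : {set G} := [set t | rho t * m%:R <= 1].

Lemma max0_lip (x y : R) : `|Num.max 0 x - Num.max 0 y| <= `|x - y|.
Proof.
have := ler_norm (x - y); have := ler_norm (y - x); rewrite (distrC y).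
by have [?|?] := lerP 0 x; have [?|?] := lerP 0 y; rewrite ?subrr ?normr0 // ler_norml; lra.
Qed.

(** Normalize the tent max(0, 1/D - rho). It is at least 1/(2D) on the ball of radius 1/(2D), so its
    mass is at least |G| / (2VD); its height 1/D then gives the density bound, and its Lipschitz
    constant 1 gives the last bound. *)
Lemma tent_prob (rho : G -> R) (D V : nat) : seminorm rho -> (0 < D)%N ->
    (#|G| <= #|ball rho (2 * D)| * V)%N ->
  exists mu : G -> R, [/\ prob mu, forall t, mu (- t) = mu t,
    forall t, mu t != 0 -> rho t * D%:R <= 1,
    forall t, mu t * #|G|%:R <= (2 * V)%:R
    & forall s, shiftvar mu s <= (2 * V * D)%:R * rho s].
Proof.
move=> sn D0 GV; have [r0 rN rD] := sn.
have D0' : 0 < D%:R :> R by rewrite ltr0n.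
have Dn0 : D%:R != 0 :> R by rewrite gt_eqF.
have G0 : 0 < #|G|%:R :> R by rewrite ltr0n; apply/card_gt0P; exists 0.
pose h t : R := Num.max 0 (D%:R^-1 - rho t); pose Z := \sum_t h t.
have h0 t : 0 <= h t by rewrite le_max lexx.
have hD t : h t * D%:R <= 1.
  have hle : h t <= D%:R^-1 by rewrite ge_max invr_ge0 ler0n; have := r0 t; lra.
  by rewrite -[leRHS](mulVf Dn0) ler_wpM2r // ltW.
have GZ : #|G|%:R <= Z * (2 * V * D)%:R.
  apply: (@le_trans _ _ (#|ball rho (2 * D)| * V)%:R); first by rewrite ler_nat.
  have -> : (2 * V * D = (2 * D) * V)%N by lia.
  rewrite !natrM mulrA ler_wpM2r ?ler0n // -natrM /Z.
  rewrite -sum1_card natr_sum big_mkcond mulr_suml /=; apply: ler_sum => t _.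
  rewrite inE; case: ifP => [bt|_]; last by rewrite mulr_ge0.
  have : D%:R^-1 - rho t <= h t by rewrite le_max lexx orbT.
  move=> /(ler_wpM2r (ltW D0')); rewrite mulrBl mulVf //.
  rewrite natrM in bt *; lra.
have Z0 : 0 < Z.
  rewrite lt_def sumr_ge0 // andbT; apply/negP => /eqP Z0.
  by move: GZ; rewrite Z0 mul0r; lra.
exists (fun t => h t / Z); split.
- split=> [t|]; first by rewrite divr_ge0 // ltW.
  by rewrite -mulr_suml divff // gt_eqF.
- by move=> t; rewrite /h rN.
- move=> t; rewrite mulf_eq0 negb_or => /andP[ht _].
  have : 0 < D%:R^-1 - rho t.
    by move: ht; rewrite /h; case: lerP => // ? /eqP.
  by rewrite subr_gt0 => /ltW /(ler_wpM2r (ltW D0')); rewrite mulVf.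
- move=> t; rewrite mulrAC ler_pdivrMr //.
  apply: le_trans (ler_wpM2l (h0 t) GZ) _.
  rewrite natrM; have := hD t; have := ler0n R (2 * V)%N; move: Z0; nra.
- move=> s; rewrite /shiftvar.
  have -> : \sum_t `|h (t + s) / Z - h t / Z| = (\sum_t `|h (t + s) - h t|) / Z.
    rewrite mulr_suml; apply: eq_bigr => t _.
    by rewrite -mulrBl normrM (@gtr0_norm _ Z^-1) ?invr_gt0.
  rewrite ler_pdivrMr //.
  have /le_trans : \sum_t `|h (t + s) - h t| <= #|G|%:R * rho s.
    rewrite mulr_natl -sumr_const; apply: ler_sum => t _.
    apply: le_trans (max0_lip _ _) _; apply: le_trans (seminorm_lip t s sn).
    by rewrite distrC opprB addrC subrKA.
  apply; rewrite mulrAC; apply: ler_wpM2r => //; by rewrite mulrC.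
Qed.

End Tent.

(** * Sampling *)

Section Sampling.
Variable R : realFieldType.

Lemma exists_le_average (W : finType) (F : W -> R) c : (0 < #|W|)%N ->
  \sum_w F w <= #|W|%:R * c -> exists w, F w <= c.
Proof.
move=> W0 Fc; apply/existsP; apply: contraLR Fc; rewrite negb_exists -ltNge.
move=> /forallP Fc; rewrite mulr_natl -sumr_const.
have /card_gt0P[w0 _] := W0.
rewrite (bigD1 w0) // [ltRHS](bigD1 w0) //= ltr_leD //; first by rewrite ltNge Fc.
by apply: ler_sum => w _; rewrite ltW // ltNge Fc.
Qed.

(* Maurey's empirical method, derandomized: each new sample is chosen so that the squared
   error grows by at most the variance. *)
Lemma maurey (W J : finType) (X : W -> J -> R) (theta : J -> R) (n : nat) :
    (0 < #|W|)%N -> (forall j, 0 <= theta j) ->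
  let m j := #|W|%:R^-1 * \sum_w X w j in
  let v := #|W|%:R^-1 * \sum_w \sum_j theta j * X w j ^+ 2 in
  exists ws : n.-tuple W,
    \sum_j theta j * (\sum_(w <- ws) X w j - n%:R * m j) ^+ 2 <= n%:R * v.
Proof.
move=> W0 th0 m v.
have Wn0 : #|W|%:R != 0 :> R by rewrite pnatr_eq0 -lt0n.
have mE j : \sum_w X w j = #|W|%:R * m j by rewrite /m mulVKf.
have vE : \sum_w \sum_j theta j * X w j ^+ 2 = #|W|%:R * v by rewrite /v mulVKf.
elim: n => [|n [ws IH]].
  exists [tuple]; rewrite mul0r big1 // => j _.
  by rewrite big_nil mul0r subr0 expr0n mulr0.
pose S j := \sum_(w <- ws) X w j - n%:R * m j.
have [w wP] : exists w, \sum_j theta j * (S j + (X w j - m j)) ^+ 2 <= n.+1%:R * v.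
  apply: exists_le_average => //.
  have -> : \sum_w \sum_j theta j * (S j + (X w j - m j)) ^+ 2 =
      #|W|%:R * \sum_j theta j * S j ^+ 2 + \sum_w \sum_j theta j * X w j ^+ 2
      - #|W|%:R * \sum_j theta j * m j ^+ 2.
    rewrite exchange_big /= [X in _ + X - _]exchange_big /= !mulr_sumr -big_split -sumrB.
    apply: eq_bigr => j _ /=.
    rewrite (eq_bigr (fun w => theta j * (S j - m j) ^+ 2 +
      (theta j * (S j - m j) *+ 2 * X w j + theta j * X w j ^+ 2))); last first.
      by move=> w _; ring.
    by rewrite !big_split /= sumr_const -mulr_natl -mulr_sumr mE; ring.
  have m0 : 0 <= #|W|%:R * \sum_j theta j * m j ^+ 2.
    by rewrite mulr_ge0 // sumr_ge0 // => j _; rewrite mulr_ge0 ?sqr_ge0.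
  have W0' : 0 <= #|W|%:R :> R by [].
  have := ler_wpM2l W0' IH; rewrite vE mulrSr; nra.
exists [tuple of w :: ws]; apply: le_trans wP; rewrite le_eqVlt; apply/orP; left.
apply/eqP/eq_bigr => j _; rewrite /S big_cons; congr (_ * _ ^+ 2); rewrite mulrSr; ring.
Qed.

Lemma pigeonhole (T P : finType) (B : {set T}) (pat : T -> P) : (0 < #|P|)%N ->
  exists p, (#|B| <= #|P| * #|[set t in B | pat t == p]|)%N.
Proof.
move=> P0; apply/existsP; apply: contraT; rewrite negb_exists => /forallP H.
have /card_gt0P[p0 _] := P0.
have E : #|B| = (\sum_p #|[set t in B | pat t == p]|)%N.
  rewrite -sum1_card (partition_big pat predT) //=; apply: eq_bigr => p _.
  by rewrite -sum1_card; apply: eq_bigl => t; rewrite inE.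
have : (#|P| * #|B| < #|P| * #|B|)%N; last by rewrite ltnn.
rewrite {1}E big_distrr /= -sum_nat_const (bigD1 p0) //= [ltnRHS](bigD1 p0) //=.
rewrite -addSn leq_add //; first by rewrite ltnNge H.
by apply: leq_sum => p _; rewrite ltnW // ltnNge H.
Qed.

Lemma markov_half (T : finType) (B : {set T}) (e : T -> R) (c : R) : 0 < c ->
    (forall t, 0 <= e t) -> \sum_(t in B) e t <= #|B|%:R * c ->
  (#|B| <= 2 * #|[set t in B | (e t <= c *+ 2)%R]|)%N.
Proof.
move=> c0 e0 ec; set B1 := [set t in B | _].
have B1B : B1 \subset B by apply/subsetP => t; rewrite inE => /andP[].
rewrite -(cardsID B1 B) (setIidPr B1B) mul2n -addnn leq_add2l.
have : #|B :\: B1|%:R * (c *+ 2) <= #|B|%:R * c.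
  apply: le_trans ec; rewrite mulr_natl -sumr_const [leRHS](big_setID B1) /=.
  rewrite -[leLHS]add0r lerD ?sumr_ge0 //; apply: ler_sum => t.
  by rewrite !inE => /andP[+ tB]; rewrite tB -ltNge => /ltW.
have -> : #|B :\: B1|%:R * (c *+ 2) = c * (2 * #|B :\: B1|)%:R.
  by rewrite natrM; ring.
rewrite [leRHS]mulrC ler_pM2l // ler_nat -(cardsID B1 B) (setIidPr B1B); lia.
Qed.

(** * Covering by sampled bit patterns *)

Section Cover.
Variables (G : finZmodType) (a : pred G).

Definition ind (x : G) : R := (a x)%:R.

Lemma ind01 x : 0 <= ind x <= 1.
Proof. by rewrite /ind; case: (a x); rewrite ?lexx ?ler01. Qed.

(** Correlation at lag [l] between the translate of the set by [t] and the set itself, seen through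
    the window [om] placed at [s]. *)
Definition loc_corr (om : G -> R) (t s l : G) :=
  \sum_w om (w - s) * (ind (w - t) * ind (w + l)).

(* The empirical approximation of [loc_corr a om t] depends on [t] only through the bits
   [a (w_i - t)] at the sample points [w_i], so shifts with equal bits are close. *)
Lemma cover_pattern (om lam : G -> R) (B : {set G}) (n : nat) (c : R) :
    prob om -> prob lam -> (0 < n)%N -> 0 < c ->
    (forall t, om t * #|G|%:R <= c) ->
  exists T : {set G}, [/\ T \subset B, (#|B| <= #|T| * 2 ^ n.+1)%N &
    forall t t', t \in T -> t' \in T ->
    \sum_s \sum_l lam l * (loc_corr om t s l - loc_corr om t' s l) ^+ 2
      <= c *+ 8 / n%:R * #|G|%:R].
Proof.
move=> pom plam n0 c0 omc.
have Gc : (0 < #|G|)%N by apply/card_gt0P; exists 0.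
set N := #|G|%:R : R.
have N0 : 0 < N by rewrite ltr0n.
have Nn0 : N != 0 by rewrite gt_eqF.
(* The factor [N] makes the uniform mean of [X] over w equal to [loc_corr]; the weight [theta] sums
   the error over t in [B] and averages it over l. *)
pose X (w : G) (j : G * G * G) :=
  N * (om (w - j.1.2) * (ind (w - j.1.1) * ind (w + j.2))).
pose theta (j : G * G * G) := (j.1.1 \in B)%:R * lam j.2.
have th0 j : 0 <= theta j by rewrite mulr_ge0 //; exact: plam.1.
have [ws wsP] := maurey X n Gc th0.
pose e t := \sum_s \sum_l lam l *
  (\sum_(w <- ws) X w (t, s, l) - n%:R * loc_corr om t s l) ^+ 2.
have mE j : #|G|%:R^-1 * \sum_w X w j = loc_corr om j.1.1 j.1.2 j.2.
  by rewrite -mulr_sumr mulKf.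
have sum3 (F : G -> G -> G -> R) :
    \sum_(j : G * G * G) (j.1.1 \in B)%:R * F j.1.1 j.1.2 j.2
    = \sum_(t in B) \sum_s \sum_l F t s l.
  rewrite -(pair_bigA _ (fun p l => (p.1 \in B)%:R * F p.1 p.2 l)) /=.
  rewrite -(pair_bigA _ (fun t s => \sum_l (t \in B)%:R * F t s l)) /=.
  rewrite [RHS]big_mkcond; apply: eq_bigr => t _; case: ifP => _.
    by apply: eq_bigr => s _; apply: eq_bigr => l _; rewrite mul1r.
  by rewrite big1 // => s _; rewrite big1 // => l _; rewrite mul0r.
have e_sum : \sum_(t in B) e t <= #|B|%:R * (n%:R * c * N).
  rewrite -(sum3 (fun t s l => lam l * (\sum_(w <- ws) X w (t, s, l)
    - n%:R * loc_corr om t s l) ^+ 2)).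
  apply: le_trans (le_trans wsP _).
    rewrite le_eqVlt; apply/orP; left; apply/eqP; apply: eq_bigr => -[[t s] l] _.
    by rewrite mE mulrA.
  have -> : #|B|%:R * (n%:R * c * N) = n%:R * (N^-1 * (c * (#|B|%:R * (N * N)))).
    by field.
  rewrite ler_wpM2l // ler_wpM2l ?invr_ge0 ?(ltW N0) //.
  have -> : c * (#|B|%:R * (N * N)) = \sum_(w : G) (#|B|%:R * (c * N)).
    by rewrite sumr_const -mulr_natl -/N; ring.
  apply: ler_sum => w _.
  rewrite (eq_bigr (fun j : G * G * G => (j.1.1 \in B)%:R *
    (lam j.2 * X w j ^+ 2))); last by move=> j _; rewrite -mulrA.
  rewrite (sum3 (fun t s l => lam l * X w (t, s, l) ^+ 2)).
  rewrite mulr_natl -sumr_const; apply: ler_sum => t _.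
  (* In the square of [X] one factor N om is bounded by [c]; the other is kept, since om(w - s) sums
     to 1 over s. *)
  have -> : c * N = \sum_s c * N * om (w - s).
    rewrite -mulr_sumr -[LHS]mulr1; congr (_ * _).
    rewrite -pom.2 -(sum_opp (fun t => om t)) -(sum_shift _ (- w)).
    by apply: eq_bigr => s _; rewrite opprD opprK addrC.
  apply: ler_sum => s _; apply: (prob_le_cst plam) => l _; rewrite /X /=.
  have := omc (w - s); have := pom.1 (w - s).
  have /andP[] := ind01 (w - t); have /andP[] := ind01 (w + l).
  rewrite -/N; set o := om _; set i := ind _; set k := ind _ => i0 i1 k0 k1 o0 oc.
  have ik1 : (k * i) ^+ 2 <= 1 by rewrite expr_le1 ?mulr_ge0 ?mulr_ile1.
  have -> : (N * (o * (k * i))) ^+ 2 = (o * N) * (N * o) * (k * i) ^+ 2 by ring.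
  have No : 0 <= N * o by rewrite mulr_ge0 // ltW.
  apply: (@le_trans _ _ (o * N * (N * o))); last by rewrite -[leRHS]mulrA ler_wpM2r.
  by rewrite ler_piMr // mulr_ge0 // mulrC.
have nN0 : 0 < n%:R * c * N by rewrite !mulr_gt0 ?ltr0n.
have e0 t : 0 <= e t.
  by do 2!apply: sumr_ge0 => ? _; rewrite mulr_ge0 ?sqr_ge0 //; exact: plam.1.
have := markov_half nN0 e0 e_sum; set B1 := [set t in B | _] => B1P.
pose pat t : n.-tuple bool := [tuple of map (fun w => a (w - t)) ws].
have [|p] := pigeonhole B1 pat; first by rewrite card_tuple card_bool expn_gt0.
set T := [set t in B1 | _]; rewrite card_tuple card_bool => TP.
exists T; split=> [||t t' tT t'T].
- by apply/subsetP => t; rewrite !inE => /andP[/andP[]].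
(* A factor 2 is lost to Markov's inequality and 2^n to the choice of the bit pattern. *)
- by rewrite expnS; move: TP B1P; set q := (2 ^ n)%N; nia.
have [et pt] : e t <= n%:R * c * N *+ 2 /\ pat t = p.
  by move: tT; rewrite !inE => /andP[/andP[_ ->] /eqP].
have [et' pt'] : e t' <= n%:R * c * N *+ 2 /\ pat t' = p.
  by move: t'T; rewrite !inE => /andP[/andP[_ ->] /eqP].
have Xtt' s l : \sum_(w <- ws) X w (t, s, l) = \sum_(w <- ws) X w (t', s, l).
  apply: eq_big_seq => w wws; rewrite /X /=.
  have /eq_in_map/(_ w wws) : map (fun w => a (w - t)) ws = map (fun w => a (w - t')) ws.
    by rewrite -[LHS]/(val (pat t)) pt -pt'.
  by rewrite /ind => ->.
have n20 : 0 < n%:R ^+ 2 :> R by rewrite exprn_gt0 // ltr0n.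
rewrite -(ler_pM2l n20).
have -> : n%:R ^+ 2 * (c *+ 8 / n%:R * N) = n%:R * c * N *+ 8.
  by field; rewrite pnatr_eq0 -lt0n.
(* Both correlations are compared with the common empirical sum, using (y - z)^2 <= 2(x - y)^2 + 2(x
   - z)^2. *)
apply: (@le_trans _ _ (e t *+ 2 + e t' *+ 2)); last by lra.
rewrite mulr_sumr -!sumrMnl -big_split; apply: ler_sum => s _ /=.
rewrite mulr_sumr -!sumrMnl -big_split; apply: ler_sum => l _ /=.
rewrite -!mulrnAr -mulrDr mulrCA ler_wpM2l ?plam.1 // Xtt'.
set x := \sum_(w <- ws) _; set y := loc_corr _ t _ _; set z := loc_corr _ t' _ _.
rewrite -subr_ge0 (_ : _ - _ = (x *+ 2 - n%:R * y - n%:R * z) ^+ 2) ?sqr_ge0 //; ring.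
Qed.

End Cover.
End Sampling.

(** * Local autocorrelations control progressions *)

Section LocalCorrelation.
Variables (R : realFieldType) (G : finZmodType).
Implicit Types (mu om lam h : G -> R).

Lemma card_pos : 0 < #|G|%:R :> R.
Proof. by rewrite ltr0n; apply/card_gt0P; exists 0. Qed.

Lemma sqr_sum_le (F : G -> R) : (\sum_x F x) ^+ 2 <= #|G|%:R * \sum_x F x ^+ 2.
Proof.
have G0 := card_pos; have Gn0 : #|G|%:R != 0 :> R by rewrite gt_eqF.
have pu : prob (fun _ : G => #|G|%:R^-1 : R).
  by split=> [_|]; rewrite ?invr_ge0 ?ltW // sumr_const -[_ *+ _]mulr_natl divff.
have := prob_sqr pu F; rewrite -!mulr_sumr exprMn expr2 -mulrA ler_pM2l ?invr_gt0 //.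
by rewrite ler_pdivrMl.
Qed.

(** The law of v - u for independent u, v of law [mu]. *)
Definition corr_law mu (l : G) := \sum_v mu v * mu (v + l).

Lemma corr_lawE mu (F : G -> R) :
  \sum_u \sum_v mu u * mu v * F (v - u) = \sum_l corr_law mu l * F l.
Proof.
rewrite [RHS](eq_bigr (fun l => \sum_v mu v * mu (v + l) * F l)); last first.
  by move=> l _; rewrite mulr_suml.
rewrite [RHS]exchange_big; apply: eq_bigr => u _ /=.
rewrite -(sum_shift _ u); apply: eq_bigr => l _.
by rewrite addrK [l + u]addrC.
Qed.

Lemma corr_law_prob mu : prob mu -> prob (corr_law mu).
Proof.
move=> p; split=> [l|]; first by apply: sumr_ge0 => v _; rewrite mulr_ge0 ?p.1.
have := corr_lawE mu (fun=> 1); rewrite [RHS](eq_bigr (corr_law mu)); last first.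
  by move=> l _; rewrite mulr1.
move=> <-; rewrite -[RHS]p.2; apply: eq_bigr => u _.
by under eq_bigr do rewrite mulr1; rewrite -mulr_sumr p.2 mulr1.
Qed.

(** [corr_law mu] is an average of translates of [mu], and averaging does not increase the L1
    variation. *)
Lemma shiftvar_corr_law mu t : prob mu -> shiftvar (corr_law mu) t <= shiftvar mu t.
Proof.
move=> p; rewrite /shiftvar -[leRHS](prob_cst p).
apply: (@le_trans _ _ (\sum_l \sum_v mu v * `|mu (v + (l + t)) - mu (v + l)|)).
  apply: ler_sum => l _; rewrite -sumrB; under eq_bigr do rewrite -mulrBr.
  exact: prob_norm_le.
rewrite exchange_big /=; apply: ler_sum => v _; rewrite -mulr_sumr.
rewrite ler_wpM2l ?p.1 // -(sum_shift (fun x => `|mu (x + t) - mu x|) v).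
rewrite le_eqVlt; apply/orP; left; apply/eqP/eq_bigr => l _.
by rewrite addrA [v + l]addrC.
Qed.

Definition window_corr om h (s l : G) := \sum_w om (w - s) * (h w * h (w + l)).

(* One Cauchy-Schwarz step removes [a], a second one removes [b]. *)
Lemma bilinear_bound mu (phi psi : G -> G) (a b : G -> G -> R) h :
    prob mu -> cancel phi psi -> cancel psi phi ->
    (forall x u, `|a x u| <= 1) -> (forall x v, `|b x v| <= 1) ->
  (\sum_x \sum_u \sum_v mu u * mu v * (a x u * b x v * h (x + phi u + v))) ^+ 4
  <= #|G|%:R ^+ 3 *
     \sum_s \sum_l corr_law mu l * window_corr (mu \o psi) h s l ^+ 2.
Proof.
move=> p phiK psiK a1 b1; set Q := \sum_x _; set N := #|G|%:R : R.
have N0 : 0 < N := card_pos.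
pose K s l := window_corr (mu \o psi) h s l.
have KE s l : K s l = \sum_u mu u * (h (s + phi u) * h (s + phi u + l)).
  rewrite /K /window_corr -(sum_shift _ s) (reindex phi) /=; last first.
    by exists psi => x _; [exact: phiK | exact: psiK].
  by apply: eq_bigr => u _; rewrite addrK phiK [s + _]addrC.
(* What remains of the sum over v once [a x u], which is independent of v, is factored out. *)
pose I x u := \sum_v mu v * (b x v * h (x + phi u + v)).
pose S := \sum_x \sum_u mu u * I x u ^+ 2.
have S0 : 0 <= S.
  by do 2!apply: sumr_ge0 => ? _; rewrite mulr_ge0 ?sqr_ge0 //; exact: p.1.
have QS : Q ^+ 2 <= N * S.
  apply: le_trans (sqr_sum_le _) _; rewrite ler_wpM2l ?(ltW N0) //; apply: ler_sum => x _.
  have -> : \sum_u \sum_v mu u * mu v * (a x u * b x v * h (x + phi u + v))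
            = \sum_u mu u * (a x u * I x u).
    apply: eq_bigr => u _; rewrite mulrA mulr_sumr; apply: eq_bigr => v _; ring.
  apply: le_trans (prob_sqr p _) _; apply: (prob_le p) => u _.
  by rewrite exprMn ler_piMl ?sqr_ge0 // -real_normK ?num_real // expr_le1.
(* Squaring [I] doubles v into v, v'; the sum over u becomes an autocorrelation of [h] at x + v with
   lag v' - v, and the two factors [b] are bounded by 1. *)
have SK : S <= \sum_s \sum_l corr_law mu l * `|K s l|.
  have -> : \sum_s \sum_l corr_law mu l * `|K s l|
      = \sum_x \sum_v \sum_v' mu v * mu v' * `|K (x + v) (v' - v)|.
    rewrite (sum3_shift mu (fun x v v' => `|K x (v' - v)|) (fun v _ => v)).
    by apply: eq_bigr => s _; rewrite -corr_lawE.
  have -> : S = \sum_x \sum_v \sum_v'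
      mu v * mu v' * (b x v * b x v' * K (x + v) (v' - v)).
    apply: eq_bigr => x _.
    rewrite (eq_bigr (fun u => \sum_v \sum_v'
       mu u * (mu v * (b x v * h (x + phi u + v)) *
              (mu v' * (b x v' * h (x + phi u + v')))))); last first.
      move=> u _; rewrite expr2 {1}/I mulr_suml mulr_sumr; apply: eq_bigr => v _.
      by rewrite mulr_sumr mulr_sumr.
    rewrite exchange_big; apply: eq_bigr => v _ /=.
    rewrite exchange_big; apply: eq_bigr => v' _ /=.
    rewrite KE !mulr_sumr; apply: eq_bigr => u _.
    have -> : x + v + phi u = x + phi u + v by rewrite addrAC.
    have -> : x + phi u + v + (v' - v) = x + phi u + v'.
      by rewrite -addrA [v + _]addrC subrK.
    ring.
  do 3!apply: ler_sum => ? _; rewrite ler_wpM2l ?mulr_ge0 ?p.1 //.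
  by apply: le_trans (ler_norm _) _; rewrite !normrM ler_piMl // mulr_ile1.
have S2 : S ^+ 2 <= N * \sum_s \sum_l corr_law mu l * K s l ^+ 2.
  apply: (@le_trans _ _ ((\sum_s \sum_l corr_law mu l * `|K s l|) ^+ 2)).
    by rewrite ler_pXn2r // nnegrE; exact: le_trans S0 SK.
  apply: le_trans (sqr_sum_le _) _; rewrite ler_wpM2l ?(ltW N0) //; apply: ler_sum => s _.
  apply: le_trans (prob_sqr (corr_law_prob p) _) _.
  by apply: ler_sum => l _; rewrite real_normK ?num_real.
have -> : Q ^+ 4 = (Q ^+ 2) ^+ 2 by ring.
apply: (@le_trans _ _ ((N * S) ^+ 2)).
  by rewrite lerXn2r // nnegrE ?sqr_ge0 // mulr_ge0 // ltW.
rewrite exprMn (_ : N ^+ 3 * _ = N ^+ 2 * (N * \sum_s \sum_l corr_law mu l * K s l ^+ 2)).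
  by rewrite ler_wpM2l ?sqr_ge0.
by rewrite /K; ring.
Qed.

Lemma window_corr_shift om h e s l :
  window_corr om (fun x => h (x + e)) s l = window_corr om h (s + e) l.
Proof.
rewrite /window_corr -[RHS](sum_shift _ e); apply: eq_bigr => w _.
by rewrite addrAC (_ : w + e - (s + e) = w - s) // opprD addrACA subrr addr0.
Qed.

(** Expanding the factor h(w + l) writes the window correlation as D(s, l - t) - D(s, l - t'), where
    D is the difference of the two [loc_corr]. Undoing each shift of l costs the variation of [lam],
    because D^2 <= 1. *)
Lemma window_corr_diff (a : pred G) om lam t t' : prob om -> prob lam ->
  \sum_s \sum_l lam l *
     window_corr om (fun x => ind R a (x - t) - ind R a (x - t')) s l ^+ 2
  <= (\sum_s \sum_l lam l * (loc_corr a om t s l - loc_corr a om t' s l) ^+ 2) *+ 4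
     + (shiftvar lam t + shiftvar lam t') *+ 2 * #|G|%:R.
Proof.
move=> pom plam; pose h x := ind R a (x - t) - ind R a (x - t').
pose D s l := loc_corr a om t s l - loc_corr a om t' s l.
have DE s l : D s l = \sum_w om (w - s) * (h w * ind R a (w + l)).
  by rewrite /D /loc_corr -sumrB; apply: eq_bigr => w _; rewrite /h; ring.
have WE s l : window_corr om h s l = D s (l - t) - D s (l - t').
  by rewrite !DE /window_corr -sumrB; apply: eq_bigr => w _; rewrite /h !addrA; ring.
have D1 s l : D s l ^+ 2 <= 1.
  have h1 w : `|h w * ind R a (w + l)| <= 1.
    rewrite normrM mulr_ile1 // ler_norml; have /andP[] := ind01 R a (w + l).
      have /andP[] := ind01 R a (w - t); have /andP[] := ind01 R a (w - t').
      by rewrite /h; lra.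
    lra.
  rewrite -real_normK ?num_real // expr_le1 // DE.
  have pom' : prob (fun w => om (w - s)).
    by split=> [w|]; [exact: pom.1 | rewrite (sum_shift om (- s)) pom.2].
  apply: le_trans (prob_norm_le pom' _) _; exact: (prob_le_cst pom').
have Dsh s r : \sum_l lam l * D s (l - r) ^+ 2
    <= \sum_l lam l * D s l ^+ 2 + shiftvar lam r.
  rewrite -(sum_shift _ r) -big_split /=; apply: ler_sum => l _; rewrite addrK.
  rewrite -lerBlDl -mulrBl; apply: le_trans (ler_norm _) _.
  by rewrite normrM ler_piMr // ger0_norm ?sqr_ge0.
rewrite mulr_natr -sumr_const -sumrMnl -big_split; apply: ler_sum => s _ /=.
apply: (@le_trans _ _ ((\sum_l lam l * D s (l - t) ^+ 2) *+ 2
                       + (\sum_l lam l * D s (l - t') ^+ 2) *+ 2)); last first.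
  have := Dsh s t; have := Dsh s t'; rewrite -/(D s _).
  have -> : \sum_l lam l * (loc_corr a om t s l - loc_corr a om t' s l) ^+ 2
    = \sum_l lam l * D s l ^+ 2 by [].
  lra.
rewrite -!sumrMnl -big_split; apply: ler_sum => l _ /=; rewrite WE.
rewrite -!mulrnAr -mulrDr ler_wpM2l ?plam.1 // -subr_ge0.
set x := D s _; set y := D s _.
by rewrite (_ : _ - _ = (x + y) ^+ 2) ?sqr_ge0 //; ring.
Qed.

End LocalCorrelation.

(** * Oscillation seminorms of families of functions *)

Section Oscillation.
Variables (R : realFieldType) (G : finZmodType).

Definition osc (I : finType) (F : I -> G -> R) (t : G) : R :=
  \big[Num.max/0]_(p : I * G) `|F p.1 (p.2 + t) - F p.1 p.2|.

Lemma osc_ge (I : finType) (F : I -> G -> R) i x t :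
  `|F i (x + t) - F i x| <= osc F t.
Proof. exact: (le_bigmax _ (fun p : I * G => `|F p.1 (p.2 + t) - F p.1 p.2|) (i, x)). Qed.

Lemma osc_le (I : finType) (F : I -> G -> R) t c : 0 <= c ->
  (forall i x, `|F i (x + t) - F i x| <= c) -> osc F t <= c.
Proof. by move=> c0 Fc; apply: bigmax_le => // p _; apply: Fc. Qed.

Lemma osc_ge0 (I : finType) (F : I -> G -> R) t : 0 <= osc F t.
Proof. exact: bigmax_ge_id. Qed.

Lemma seminorm_osc (I : finType) (F : I -> G -> R) : seminorm (osc F).
Proof.
have oN s : osc F (- s) <= osc F s.
  apply: osc_le => [|i x]; first exact: osc_ge0.
  by rewrite distrC -{1}(subrK s x) osc_ge.
split=> [s|s|s t]; first exact: osc_ge0.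
  by apply: le_anti; rewrite oN -{1}(opprK s) oN.
apply: osc_le => [|i x]; first by rewrite addr_ge0 ?osc_ge0.
have := osc_ge F i x s; have := osc_ge F i (x + s) t; rewrite addrA.
set A := F i _; set B := F i _; set C := F i _.
have := ler_normD (A - B) (B - C); rewrite addrA subrK; lra.
Qed.

End Oscillation.

(** * Progression counts under translation of one factor *)

Section Progressions.
Variables (R : realFieldType) (G : finZmodType) (a : pred G).
Variable half : G -> G.
Hypotheses (dblK : cancel (@dbl G) half) (halfK : cancel half (@dbl G)).
Implicit Types (mu f g h : G -> R).

Let N : R := #|G|%:R.
Let f0 : G -> R := ind R a.

(** Start from the last term and exchange u and v, which reverses the sign of the difference. *)
Lemma ap_form_rev mu f1 f2 f3 : ap_form mu f1 f2 f3 = ap_form mu f3 f2 f1.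
Proof.
rewrite /ap_form -(sum3_shift mu (fun x u v => f1 x * f2 (x + (v - u)) * f3 (x + dbl (v - u)))
  (fun u v => - dbl (v - u))).
rewrite -[LHS]sum3_sym; apply: eq_bigr => x _; apply: eq_bigr => u _.
apply: eq_bigr => v _; congr (_ * _); rewrite subrK.
have -> : - dbl (u - v) = dbl (v - u) by rewrite /dbl opprD !opprB.
have -> : x + dbl (v - u) + (u - v) = x + (v - u).
  by rewrite -(opprB v u) /dbl addrA addrK.
by ring.
Qed.

Definition trip mu (x y z : G) : R :=
  N^-1 * ap_form mu (fun w => f0 (w + x)) (fun w => f0 (w + y)) (fun w => f0 (w + z)).

Lemma trip_rev mu x y z : trip mu x y z = trip mu z y x.
Proof. by rewrite /trip ap_form_rev. Qed.

(** Replacing x by x + 2u - v makes the terms x + 2u - v, x + u, x + v: the last two involve one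
    variable each. Symmetry of [mu] allows v to be replaced by -v, which gives the shape of
    [bilinear_bound] with doubling for [phi]. *)
Lemma ap_form_slot1 mu h f2 f3 : prob mu -> (forall t, mu (- t) = mu t) ->
    (forall x, `|f2 x| <= 1) -> (forall x, `|f3 x| <= 1) ->
  ap_form mu h f2 f3 ^+ 4 <= N ^+ 3 *
     \sum_s \sum_l corr_law mu l * window_corr (mu \o half) h s l ^+ 2.
Proof.
move=> p muN f21 f31.
have := bilinear_bound h p dblK halfK (a := fun x u => f2 (x + u))
  (b := fun x v => f3 (x - v)) (fun _ _ => f21 _) (fun _ _ => f31 _).
congr (_ ^+ 4 <= _); rewrite /ap_form.
rewrite -[RHS](sum3_shift mu (fun x u v => h x * f2 (x + (v - u)) * f3 (x + dbl (v - u)))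
  (fun u v => dbl u - v)).
apply: eq_bigr => x _; apply: eq_bigr => u _.
rewrite [RHS](reindex_inj oppr_inj) /=; apply: eq_bigr => v _.
rewrite muN opprK (addrA x (dbl u)); congr (_ * _).
have -> : x + dbl u + v + (- v - u) = x + u.
  by rewrite /dbl addrA addrK addrA addrK.
have -> : x + dbl u + v + dbl (- v - u) = x - v.
  by rewrite /dbl addrA !(addrA _ (- v)) addrK addrA addrK addrAC addrK.
by ring.
Qed.

(** Replacing x by x + 2u makes the terms x + 2u, x + u + v, x + 2v. *)
Lemma ap_form_slot2 mu f1 h f3 : prob mu ->
    (forall x, `|f1 x| <= 1) -> (forall x, `|f3 x| <= 1) ->
  ap_form mu f1 h f3 ^+ 4 <= N ^+ 3 *
     \sum_s \sum_l corr_law mu l * window_corr mu h s l ^+ 2.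
Proof.
move=> p f11 f31.
have := bilinear_bound h p (phi := id) (psi := id) (fun _ => erefl) (fun _ => erefl)
  (a := fun x u => f1 (x + dbl u))
  (b := fun x v => f3 (x + dbl v)) (fun _ _ => f11 _) (fun _ _ => f31 _).
congr (_ ^+ 4 <= _); rewrite /ap_form.
rewrite -[RHS](sum3_shift mu (fun x u v => f1 x * h (x + (v - u)) * f3 (x + dbl (v - u)))
  (fun u v => dbl u)).
apply: eq_bigr => x _; apply: eq_bigr => u _; apply: eq_bigr => v _; congr (_ * _).
have -> : x + dbl u + (v - u) = x + u + v.
  by rewrite /dbl [v - u]addrC !addrA addrK.
have -> : x + dbl u + dbl (v - u) = x + dbl v.
  by rewrite dblB addr_cancel.
by ring.
Qed.

Lemma ap_formBl mu f g f2 f3 :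
  ap_form mu (fun w => f w - g w) f2 f3 = ap_form mu f f2 f3 - ap_form mu g f2 f3.
Proof. by rewrite -!sumrB; do 3!(apply: eq_bigr => ? _; rewrite -?sumrB); ring. Qed.

Lemma ap_formBm mu f g f1 f3 :
  ap_form mu f1 (fun w => f w - g w) f3 = ap_form mu f1 f f3 - ap_form mu f1 g f3.
Proof. by rewrite -!sumrB; do 3!(apply: eq_bigr => ? _; rewrite -?sumrB); ring. Qed.

Lemma f0_norm x : `|f0 x| <= 1.
Proof. by have /andP[? ?] := ind01 R a x; rewrite /f0 ger0_norm. Qed.

Lemma fourth_root (Q Y : R) (m : nat) : Q ^+ 4 <= N ^+ 3 * Y ->
  Y * (m ^ 4)%:R <= N -> `|N^-1 * Q| * m%:R <= 1.
Proof.
have N0 : 0 < N := card_pos R G; have Nn0 : N != 0 by rewrite gt_eqF.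
move=> QY YN; rewrite -(@expr_le1 _ 4) ?mulr_ge0 //.
have -> : (`|N^-1 * Q| * m%:R) ^+ 4 = N^-1 ^+ 4 * (Q ^+ 4 * (m ^ 4)%:R).
  rewrite exprMn (_ : `|_| ^+ 4 = (`|N^-1 * Q| ^+ 2) ^+ 2); last by ring.
  by rewrite real_normK ?num_real // natrX; ring.
rewrite exprVn mulrC ler_pdivrMr ?exprn_gt0 // mul1r.
apply: (@le_trans _ _ (N ^+ 3 * (Y * (m ^ 4)%:R))).
  by rewrite mulrA ler_wpM2r.
by rewrite (exprSr N 3) ler_wpM2l // exprn_ge0 // ltW.
Qed.

(** With these constants the bound of [window_corr_diff] is N / m^4: its correlation term and its
    variation term are each at most N / (2 m^4). *)
Definition smallness (m : nat) := (8 * m ^ 4)%N.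
Definition samples (V m : nat) := (128 * V * m ^ 4)%N.

Lemma window_corr_small om lam (V m : nat) t t' e : prob om -> prob lam ->
    (0 < V)%N -> (0 < m)%N ->
    shiftvar lam t * (smallness m)%:R <= 1 -> shiftvar lam t' * (smallness m)%:R <= 1 ->
    \sum_s \sum_l lam l * (loc_corr a om t s l - loc_corr a om t' s l) ^+ 2
      <= (2 * V)%:R *+ 8 / (samples V m)%:R * N ->
  (\sum_s \sum_l lam l *
     window_corr om (fun w => f0 (w + e - t) - f0 (w + e - t')) s l ^+ 2)
     * (m ^ 4)%:R <= N.
Proof.
move=> pom plam V0 m0 st st' close.
have N0 : 0 < N := card_pos R G.
have m40 : 0 < m%:R ^+ 4 :> R by rewrite exprn_gt0 // ltr0n.
have -> : \sum_s \sum_l lam l *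
     window_corr om (fun w => f0 (w + e - t) - f0 (w + e - t')) s l ^+ 2
  = \sum_s \sum_l lam l * window_corr om (fun w => f0 (w - t) - f0 (w - t')) s l ^+ 2.
  rewrite -[RHS](sum_shift _ e); apply: eq_bigr => s _; apply: eq_bigr => l _.
  by rewrite -window_corr_shift.
have W := window_corr_diff a t t' pom plam.
rewrite -ler_pdivlMr; last by rewrite ltr0n expn_gt0 m0.
apply: le_trans W _; rewrite -/N.
have E : (2 * V)%:R *+ 8 / (samples V m)%:R * N = N / m%:R ^+ 4 / 8.
  rewrite /samples (natrM _ (128 * V)) (natrM _ 128) (natrM _ 2) natrX; field.
  by rewrite !pnatr_eq0 -!lt0n V0 m0.
rewrite E in close.
have sm x : x * (smallness m)%:R <= 1 -> x * N <= N / m%:R ^+ 4 / 8.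
  rewrite /smallness (natrM _ 8) natrX => x1.
  rewrite !ler_pdivlMr ?ltr0n //; have := ler_wpM2r (ltW N0) x1; rewrite mul1r; lra.
rewrite natrX; move: close (sm _ st) (sm _ st').
have -> : (shiftvar lam t + shiftvar lam t') *+ 2 * N
  = (shiftvar lam t * N + shiftvar lam t' * N) *+ 2 by ring.
set y := N / m%:R ^+ 4; lra.
Qed.

(** The change is itself a progression count, with a difference of two translates of the indicator
    in the moved slot. *)
Lemma trip_slot1 mu p q x t t' : trip mu (x + (t - t')) p q - trip mu x p q =
  N^-1 * ap_form mu (fun w => f0 (w + (x + t) - t') - f0 (w + (x + t) - t))
    (fun w => f0 (w + p)) (fun w => f0 (w + q)).
Proof.
have sh w : w + (x + (t - t')) = w + (x + t) - t' by rewrite !addrA.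
have sh0 w : w + (x + t) - t = w + x by rewrite addrA addrK.
rewrite ap_formBl mulrBr /trip /ap_form; congr (_ * _ - _ * _).
  by do 3!apply: eq_bigr => ? _; rewrite sh.
by do 3!apply: eq_bigr => ? _; rewrite sh0.
Qed.

Lemma trip_slot2 mu p q x t t' : trip mu p (x + (t - t')) q - trip mu p x q =
  N^-1 * ap_form mu (fun w => f0 (w + p))
    (fun w => f0 (w + (x + t) - t') - f0 (w + (x + t) - t)) (fun w => f0 (w + q)).
Proof.
have sh w : w + (x + (t - t')) = w + (x + t) - t' by rewrite !addrA.
have sh0 w : w + (x + t) - t = w + x by rewrite addrA addrK.
rewrite ap_formBm mulrBr /trip /ap_form; congr (_ * _ - _ * _).
  by do 3!apply: eq_bigr => ? _; rewrite sh.
by do 3!apply: eq_bigr => ? _; rewrite sh0.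
Qed.

Definition osc1 mu := osc (fun (p : G * G) x => trip mu x p.1 p.2).
Definition osc2 mu := osc (fun (p : G * G) x => trip mu p.1 x p.2).

(** [cover_pattern] is applied twice, with window [mu] composed with [half] for the outer slot, then
    inside the resulting set with window [mu] for the middle slot. *)
Lemma osc_cover mu (B : {set G}) (V m : nat) : prob mu -> (forall t, mu (- t) = mu t) ->
    (forall t, mu t * N <= (2 * V)%:R) -> (0 < V)%N -> (0 < m)%N ->
    (forall t, t \in B -> shiftvar mu t * (smallness m)%:R <= 1) ->
  exists T : {set G}, [/\ T \subset B, (#|B| <= #|T| * 2 ^ (2 * (samples V m).+1))%N &
    forall t t', t \in T -> t' \in T ->
    osc1 mu (t - t') * m%:R <= 1 /\ osc2 mu (t - t') * m%:R <= 1].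
Proof.
move=> p muN muV V0 m0 Bsmall.
have n0 : (0 < samples V m)%N by rewrite /samples muln_gt0 expn_gt0 m0 muln_gt0 V0.
have c0 : 0 < (2 * V)%:R :> R by rewrite ltr0n muln_gt0.
have plam := corr_law_prob p.
have lamB t : t \in B -> shiftvar (corr_law mu) t * (smallness m)%:R <= 1.
  by move/Bsmall; apply: le_trans; rewrite ler_wpM2r // shiftvar_corr_law.
have phalf : prob (mu \o half).
  split=> [t|]; first exact: p.1.
  rewrite -p.2 [LHS](reindex (@dbl G)) /=; last first.
    by exists half => x _; [exact: dblK | exact: halfK].
  by apply: eq_bigr => t _; rewrite dblK.
have [T1 [T1B cT1 T1P]] := cover_pattern a B phalf plam n0 c0 (fun t => muV (half t)).
have [T2 [T2T1 cT2 T2P]] := cover_pattern a T1 p plam n0 c0 muV.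
exists T2; split.
- exact: subset_trans T1B.
- rewrite mul2n -addnn expnD; nia.
have mR : 0 < m%:R :> R by rewrite ltr0n.
move=> t t' tT t'T.
have tT1 := subsetP T2T1 _ tT; have t'T1 := subsetP T2T1 _ t'T.
have st := lamB _ (subsetP T1B _ tT1); have st' := lamB _ (subsetP T1B _ t'T1).
split; rewrite -ler_pdivlMr // mul1r; (apply: osc_le; first by rewrite invr_ge0) => -[i j] x /=.
  rewrite -[leRHS]mul1r ler_pdivlMr // trip_slot1.
  apply: fourth_root (ap_form_slot1 _ _ _ _ _) _ => //; first by move=> ?; apply: f0_norm.
    by move=> ?; apply: f0_norm.
  exact: (window_corr_small _ phalf plam V0 m0 st' st (T1P _ _ t'T1 tT1)).
rewrite -[leRHS]mul1r ler_pdivlMr // trip_slot2.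
apply: fourth_root (ap_form_slot2 _ _ _ _) _ => //; first by move=> ?; apply: f0_norm.
  by move=> ?; apply: f0_norm.
exact: (window_corr_small _ p plam V0 m0 st' st (T2P _ _ t'T tT)).
Qed.

End Progressions.

(** * One stage of the energy increment *)

Section Stage.
Variables (R : realFieldType) (G : finZmodType) (a : pred G).
Variable half : G -> G.
Hypotheses (dblK : cancel (@dbl G) half) (halfK : cancel half (@dbl G)).
Implicit Types (mu beta f g h rho : G -> R).

Let N : R := #|G|%:R.
Let f0 : G -> R := ind R a.

(* A modulus of total boundedness of the form [2 ^ (A m) ^ A] is stable, up to
   enlarging [A], under the substitutions of [m] that occur in a stage. *)
Definition tame rho (A : nat) :=
  forall m, (0 < m)%N -> (#|G| <= #|ball rho m| * 2 ^ ((A * m) ^ A))%N.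

(** The modulus of total boundedness at the scale 2D required by [tent_prob]. Then [refined] is the
    exponent of the refined seminorm, and [next_bound] that of the variation of the next measure. *)
Definition index_bound (A D : nat) := (2 ^ ((A * (2 * D)) ^ A))%N.
Definition refined (A D : nat) := (32 * A * index_bound A D * D)%N.
Definition next_bound (A D : nat) :=
  (2 * refined A D * index_bound (refined A D) D * D)%N.

Lemma index_bound_gt0 A D : (0 < index_bound A D)%N.
Proof. by rewrite expn_gt0. Qed.

Lemma tent_tame rho A D : seminorm rho -> (0 < D)%N -> tame rho A ->
  exists mu : G -> R, [/\ prob mu, forall t, mu (- t) = mu t,
    forall t, mu t != 0 -> rho t * D%:R <= 1,
    forall t, mu t * N <= (2 * index_bound A D)%:R
    & forall s, shiftvar mu s <= (2 * index_bound A D * D)%:R * rho s].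
Proof. by move=> sn D0 tA; apply: tent_prob => //; apply: tA; rewrite muln_gt0. Qed.

(** With W = AVD and Y = 32Wm, both summands are at most Y^(4A), and 2 Y^(4A) <= Y^(4A + 1) <=
    Y^(32W). *)
Lemma refined_exponent A V D m : (0 < A)%N -> (0 < V)%N -> (0 < D)%N -> (0 < m)%N ->
  (2 * (samples V (4 * m)).+1 + (A * (2 * V * D * smallness (4 * m))) ^ A
   <= (32 * A * V * D * m) ^ (32 * A * V * D))%N.
Proof.
move=> A0 V0 D0 m0; rewrite /samples /smallness.
have VW : (V <= A * V * D)%N by rewrite mulnAC leq_pmull // muln_gt0 A0.
have AW : (A <= A * V * D)%N by rewrite -mulnA leq_pmulr // muln_gt0 V0.
have -> : (32 * A * V * D * m = 8 * (A * V * D) * (4 * m))%N by ring.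
have -> : (32 * A * V * D = 32 * (A * V * D))%N by ring.
have -> w : (A * (2 * V * D * (8 * w)) = 16 * (A * V * D) * w)%N by ring.
move: VW AW; set W := (A * V * D)%N; set w := (4 * m)%N => VW AW.
have w0 : (0 < w ^ 4)%N by rewrite expn_gt0 muln_gt0 m0.
set Y := (8 * W * w)%N.
have Y2 : (2 <= Y)%N by rewrite /Y /w; nia.
have W4 : (W <= W ^ 4)%N by rewrite -[X in (X <= _)%N]expn1 leq_pexp2l //; lia.
have Y4 : (Y ^ 4 = 4096 * (W ^ 4 * w ^ 4))%N by rewrite /Y !expnMn -mulnA (_ : 8 ^ 4 = 4096)%N.
have le4 : (W * w ^ 4 <= W ^ 4 * w ^ 4)%N by rewrite leq_mul2r W4 orbT.
have le1 : (V * w ^ 4 <= W * w ^ 4)%N by rewrite leq_mul2r VW orbT.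
have V4 : (0 < V * w ^ 4)%N by rewrite muln_gt0 V0.
have e1 : (2 * (128 * V * w ^ 4).+1 <= Y ^ 4)%N.
  by rewrite Y4 -(mulnA 128); lia.
have e2 : (16 * W * w ^ 4 <= Y ^ 4)%N by rewrite Y4 -(mulnA 16); lia.
apply: (@leq_trans (Y ^ (4 * A) + Y ^ (4 * A))).
  apply: leq_add; last by rewrite expnM leq_exp2r.
  by apply: leq_trans e1 _; rewrite leq_pexp2l ?leq_pmulr //; lia.
rewrite addnn -mul2n; apply: (@leq_trans (Y ^ (4 * A).+1)).
  by rewrite expnS leq_mul2r Y2 orbT.
by rewrite leq_pexp2l; lia.
Qed.

(* [osc1] also controls the last term of a progression, by [trip_rev]. *)
Definition refined_norm mu rho t := rho t + (osc1 a mu t + osc2 a mu t).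

Lemma seminorm_refined mu rho : seminorm rho -> seminorm (refined_norm mu rho).
Proof. by move=> sn; apply/seminormD/seminormD => //; apply: seminorm_osc. Qed.

(** The set [T] of [osc_cover], translated by one of its points, lies in the refined ball: the old
    seminorm contributes 2/(4m) and each oscillation 1/(4m). *)
Lemma refined_tame mu rho A D : seminorm rho -> (0 < A)%N -> (0 < D)%N -> tame rho A ->
    prob mu -> (forall t, mu (- t) = mu t) ->
    (forall t, mu t * N <= (2 * index_bound A D)%:R) ->
    (forall s, shiftvar mu s <= (2 * index_bound A D * D)%:R * rho s) ->
  tame (refined_norm mu rho) (refined A D).
Proof.
move=> sn A0 D0 tA p muN muV muL m m0; have [rho0 rhoN rhoD] := sn.
set V := index_bound A D in muV muL; have V0 : (0 < V)%N := index_bound_gt0 A D.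
(* Radius 1/m' makes the variation of [mu] at most 1/[smallness (4 * m)], and it is also at most
   1/(4m). *)
pose m' := (2 * V * D * smallness (4 * m))%N.
have m40 : (0 < 4 * m)%N by rewrite muln_gt0.
have sm0 : (0 < smallness (4 * m))%N by rewrite /smallness muln_gt0 expn_gt0 m40.
have m'0 : (0 < m')%N by rewrite /m' muln_gt0 sm0 andbT muln_gt0 D0 muln_gt0 V0.
have [t tB|T [TB cT Tosc]] :=
  @osc_cover R G a half dblK halfK mu (ball rho m') V (4 * m) p muN muV V0 m40.
  have := tB; rewrite inE; apply: le_trans; rewrite /m' natrM mulrA.
  by rewrite ler_wpM2r // mulrC.
have GB := tA _ m'0.
have [t1 t1T] : exists t, t \in T.
  apply/set0Pn; apply/eqP => T0; have : (0 < #|G|)%N by apply/card_gt0P; exists 0.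
  by apply/negP; rewrite -leqNgt; move: GB cT; rewrite T0 cards0; lia.
have TR : (#|T| <= #|ball (refined_norm mu rho) m|)%N.
  rewrite -(card_imset T (addIr (- t1))) subset_leq_card //.
  apply/subsetP => _ /imsetP[t tT ->]; rewrite inE /refined_norm !mulrDl.
  have [o1 o2] := Tosc _ _ tT t1T.
  have := subsetP TB _ tT; have := subsetP TB _ t1T; rewrite !inE => h1 h.
  have m4 : 4 * m%:R <= m'%:R :> R.
    rewrite -natrM ler_nat /m' /smallness.
    have : (4 * m <= (4 * m) ^ 4)%N by rewrite -[X in (X <= _)%N]expn1 leq_pexp2l.
    have : (0 < V * D)%N by rewrite muln_gt0 V0.
    by set y := ((4 * m) ^ 4)%N; nia.
  have h4 s : rho s * m'%:R <= 1 -> rho s * (4 * m%:R) <= 1.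
    by apply: le_trans; rewrite ler_wpM2l.
  have := ler_wpM2r (ler0n R m) (seminormB t t1 sn).
  move: (h4 _ h) (h4 _ h1) o1 o2; rewrite natrM mulrDl; lra.
apply: leq_trans GB _; apply: (@leq_trans (#|T| * 2 ^ (2 * (samples V (4 * m)).+1 + (A * m') ^ A))).
  by rewrite expnD mulnA leq_mul2r cT orbT.
apply: leq_mul => //; rewrite leq_pexp2l //; exact: refined_exponent.
Qed.

Lemma tent_shiftvar_tame beta rho A D : (0 < A)%N -> (0 < D)%N -> tame rho A ->
    (forall s, shiftvar beta s <= (2 * index_bound A D * D)%:R * rho s) ->
  tame (shiftvar beta) (2 * A * index_bound A D * D).
Proof.
move=> A0 D0 tA bL m m0; have V0 := index_bound_gt0 A D.
have k0 : (0 < 2 * index_bound A D * D * m)%N by rewrite !muln_gt0 V0 D0 m0.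
apply: leq_trans (tA _ k0) _; apply: leq_mul.
  apply/subset_leq_card/subsetP => s; rewrite !inE; apply: le_trans.
  by rewrite natrM mulrA ler_wpM2r // mulrC.
rewrite leq_pexp2l // (_ : (A * _)%N = 2 * A * index_bound A D * D * m)%N; last by nia.
have VD : (0 < index_bound A D * D)%N by rewrite muln_gt0 V0.
rewrite leq_pexp2l //; first by rewrite !muln_gt0 A0 V0 D0.
by rewrite mulnAC -!mulnA mulnC -mulnA leq_pmulr //; lia.
Qed.

End Stage.

(** * Doubling of the energy excess *)

Section EnergyIncrement.
Variables (R : realFieldType) (G : finZmodType) (a : pred G).
Implicit Types (mu beta f g h rho : G -> R).

Let N : R := #|G|%:R.
Let f0 : G -> R := ind R a.

Lemma smooth_near2 (phi psi : G -> G) mu beta h rho d1 d2 x : prob mu -> prob beta ->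
    (forall x y, `|h (x + y) - h x| <= rho y) ->
    (forall t, mu t != 0 -> rho (phi t) <= d1) ->
    (forall t, beta t != 0 -> rho (psi t) <= d2) ->
  `|smooth phi mu (smooth psi beta h) x - h x| <= d1 + d2.
Proof.
move=> pm pb hL s1 s2; rewrite -(prob_cst pm (h x)) /smooth -sumrB.
under eq_bigr do rewrite -mulrBr.
apply: le_trans (prob_norm_le pm _) _; apply: (prob_le_cst pm) => t /s1 mt.
have b2 := smooth_near (x + phi t) pb hL s2; have b1 := hL x (phi t).
rewrite -(subrKA (h (x + phi t))).
by apply: le_trans (ler_normD _ _) _; rewrite addrC lerD //; exact: le_trans mt.
Qed.

(** Smoothings commute, so smoothing the right-hand function further by [beta0] gives nearly the
    [beta0]-smoothing of [f0], which hardly varies along [mu] and [beta]; and smoothing does not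
    increase energy. *)
Lemma energy_smooth_ge (phi : G -> G) mu beta beta0 d1 d2 :
    prob mu -> prob beta -> prob beta0 ->
    (forall t, mu t != 0 -> shiftvar beta0 (phi t) <= d1) ->
    (forall t, beta t != 0 -> shiftvar beta0 t <= d2) ->
  energy (smooth id beta0 f0)
  <= energy (smooth phi mu (smooth id beta f0)) + (d1 + d2) *+ 3 * N.
Proof.
move=> pm pb p0 s1 s2.
have f01 x : 0 <= f0 x <= 1 by exact: ind01.
have fge x : 0 <= f0 x by case/andP: (f01 x).
have fle x : f0 x <= 1 by case/andP: (f01 x).
have F0L x y : `|smooth id beta0 f0 (x + y) - smooth id beta0 f0 x| <= shiftvar beta0 y.
  by apply: smooth_lip => z; rewrite ger0_norm.
pose g := smooth phi mu (smooth id beta f0).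
have g0 x : 0 <= g x by do 2!apply: smooth_ge0 => //.
have g1 x : g x <= 1 by do 2!apply: smooth_le1 => //.
have gE x : smooth id beta0 g x = smooth phi mu (smooth id beta (smooth id beta0 f0)) x.
  rewrite /g smoothC; apply: eq_bigr => t _; congr (_ * _); exact: smoothC.
have near x : `|smooth id beta0 g x - smooth id beta0 f0 x| <= d1 + d2.
  by rewrite gE; apply: (smooth_near2 (rho := shiftvar beta0)).
apply: (le_trans (energy_near _ _ near)) => [x|x|].
- by rewrite smooth_ge0 ?smooth_le1.
- by rewrite smooth_ge0 ?smooth_le1.
- by rewrite lerD2r energy_smooth.
Qed.

Lemma ap_form_smooth1 mu beta g f2 f3 : ap_form mu (smooth id beta g) f2 f3
  = \sum_t beta t * ap_form mu (fun w => g (w + t)) f2 f3.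
Proof.
under [RHS]eq_bigr do rewrite mulr_sumr.
rewrite [RHS]exchange_big; apply: eq_bigr => x _ /=.
under [RHS]eq_bigr do rewrite mulr_sumr.
rewrite [RHS]exchange_big; apply: eq_bigr => u _ /=.
under [RHS]eq_bigr do rewrite mulr_sumr.
rewrite [RHS]exchange_big; apply: eq_bigr => v _ /=.
rewrite /smooth 2!mulr_suml mulr_sumr; apply: eq_bigr => t _; ring.
Qed.

Lemma ap_form_smooth2 mu beta g f1 f3 : ap_form mu f1 (smooth id beta g) f3
  = \sum_t beta t * ap_form mu f1 (fun w => g (w + t)) f3.
Proof.
under [RHS]eq_bigr do rewrite mulr_sumr.
rewrite [RHS]exchange_big; apply: eq_bigr => x _ /=.
under [RHS]eq_bigr do rewrite mulr_sumr.
rewrite [RHS]exchange_big; apply: eq_bigr => u _ /=.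
under [RHS]eq_bigr do rewrite mulr_sumr.
rewrite [RHS]exchange_big; apply: eq_bigr => v _ /=.
rewrite /smooth mulr_sumr mulr_suml mulr_sumr; apply: eq_bigr => t _; ring.
Qed.

Lemma ap_form_smooth3 mu beta g f1 f2 : ap_form mu f1 f2 (smooth id beta g)
  = \sum_t beta t * ap_form mu f1 f2 (fun w => g (w + t)).
Proof.
rewrite ap_form_rev ap_form_smooth1; apply: eq_bigr => t _.
by rewrite ap_form_rev.
Qed.

(** The arguments are reset to 0 one at a time, the third after reversing the progression. *)
Lemma trip_osc mu x y z :
  trip a mu x y z <= trip a mu 0 0 0 + osc1 a mu x + osc2 a mu y + osc1 a mu z.
Proof.
have := osc_ge (fun (p : G * G) x => trip a mu x p.1 p.2) (y, z) 0 x.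
have := osc_ge (fun (p : G * G) x => trip a mu p.1 x p.2) (0, z) 0 y.
have := osc_ge (fun (p : G * G) x => trip a mu x p.1 p.2) (0, 0) 0 z.
rewrite /= !add0r -/(osc1 a mu _) -/(osc1 a mu _) -/(osc2 a mu _).
rewrite (trip_rev a mu z 0 0) => /ler_normlW h1 /ler_normlW h2 /ler_normlW h3; lra.
Qed.

Lemma ap_form_smooth_le mu beta d : prob beta ->
    (forall t, beta t != 0 -> osc1 a mu t <= d) ->
    (forall t, beta t != 0 -> osc2 a mu t <= d) ->
  ap_form mu (smooth id beta f0) (smooth id beta f0) (smooth id beta f0)
  <= ap_form mu f0 f0 f0 + d *+ 3 * N.
Proof.
move=> pb o1 o2; have N0 : 0 < N := card_pos R G.
rewrite ap_form_smooth1; apply: (prob_le_cst pb) => x bx.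
rewrite ap_form_smooth2; apply: (prob_le_cst pb) => y by_.
rewrite ap_form_smooth3; apply: (prob_le_cst pb) => z bz.
have E p q r : ap_form mu (fun w => f0 (w + p)) (fun w => f0 (w + q)) (fun w => f0 (w + r))
    = N * trip a mu p q r by rewrite /trip mulVKf // gt_eqF.
have E0 : ap_form mu f0 f0 f0 = N * trip a mu 0 0 0.
  by rewrite -E; do 3!apply: eq_bigr => ? _; rewrite !addr0.
rewrite E E0 [_ * N]mulrC -mulrDr ler_wpM2l ?(ltW N0) //.
apply: le_trans (trip_osc _ _ _ _) _.
have := o1 _ bx; have := o2 _ by_; have := o1 _ bz; lra.
Qed.

Definition ap_count (l : G) : R := \sum_x f0 x * f0 (x + l) * f0 (x + dbl l).

(** The difference 0 has probability the sum of mu^2, at most K/N, and count at most N; it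
    contributes at most [K]. *)
Lemma ap_form_popular mu K c : prob mu -> (forall t, mu t * N <= K) -> 0 <= c ->
  (forall l, l != 0 -> ap_count l <= c) -> ap_form mu f0 f0 f0 <= K + c.
Proof.
move=> p muK c0 apc; have N0 : 0 < N := card_pos R G.
have -> : ap_form mu f0 f0 f0 = \sum_l corr_law mu l * ap_count l.
  rewrite -corr_lawE /ap_form exchange_big; apply: eq_bigr => u _ /=.
  rewrite exchange_big; apply: eq_bigr => v _ /=.
  by rewrite /ap_count mulr_sumr.
have pl := corr_law_prob p.
have f01 x : 0 <= f0 x <= 1 by exact: ind01.
rewrite (bigD1 0) //=; apply: lerD; last first.
  rewrite -[leRHS](prob_cst pl) [leRHS](bigD1 0) //= -[leLHS]add0r; apply: lerD.
    by rewrite mulr_ge0 ?pl.1.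
  by apply: ler_sum => l l0; rewrite ler_wpM2l ?pl.1 ?apc.
have cN : ap_count 0 <= N.
  rewrite /N -sumr_const; apply: ler_sum => x _.
  have /andP[y0 y1] := f01 x; rewrite /dbl !addr0.
  by rewrite mulr_ile1 ?mulr_ge0 // mulr_ile1.
apply: (@le_trans _ _ (corr_law mu 0 * N)); first by rewrite ler_wpM2l ?pl.1.
rewrite /corr_law mulr_suml; under eq_bigr do rewrite addr0 -mulrA.
exact: (prob_le_cst p).
Qed.

Variable half : G -> G.
Hypotheses (dblK : cancel (@dbl G) half) (halfK : cancel half (@dbl G)).

Lemma stage beta0 A D c : prob beta0 -> tame (shiftvar beta0) A ->
    (0 < A)%N -> (0 < D)%N -> 0 <= c -> (forall l, l != 0 -> ap_count l <= c) ->
    (2 * index_bound A D * D <= #|G|)%N ->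
  exists beta, [/\ prob beta, tame (shiftvar beta) (next_bound A D) &
    energy (smooth id beta0 f0) *+ 2 - c - N / D%:R *+ 18
    <= energy (smooth id beta f0)].
Proof.
move=> p0 t0 A0 D0 c0 apc GD.
have D0' : 0 < D%:R :> R by rewrite ltr0n.
have sn0 := seminorm_shiftvar beta0.
have [mu [pm muN ms mK mL]] := tent_tame sn0 D0 t0.
have sn1 := seminorm_refined a mu sn0.
have r0 : (0 < refined A D)%N by rewrite /refined !muln_gt0 A0 D0 index_bound_gt0.
have t1 := refined_tame a dblK halfK sn0 A0 D0 t0 pm muN mK mL.
have [beta [pb _ bs bK bL]] := tent_tame sn1 D0 t1.
exists beta; split=> //; first exact: (tent_shiftvar_tame r0 D0 t1 bL).
have [[r0_ _ _] o1_ o2_] : [/\ seminorm (shiftvar beta0),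
    forall t, 0 <= osc1 a mu t & forall t, 0 <= osc2 a mu t].
  by split=> // t; exact: osc_ge0.
have sm t : mu t != 0 -> shiftvar beta0 t <= D%:R^-1.
  by move/ms => h; rewrite -[leRHS]mul1r ler_pdivlMr.
have sb t : beta t != 0 -> refined_norm a mu (shiftvar beta0) t <= D%:R^-1.
  by move/bs => h; rewrite -[leRHS]mul1r ler_pdivlMr.
have sb0 t : beta t != 0 -> shiftvar beta0 t <= D%:R^-1.
  by move/sb; have := o1_ t; have := o2_ t; rewrite /refined_norm; lra.
have sb1 t : beta t != 0 -> osc1 a mu t <= D%:R^-1.
  by move/sb; have := r0_ t; have := o2_ t; rewrite /refined_norm; lra.
have sb2 t : beta t != 0 -> osc2 a mu t <= D%:R^-1.
  by move/sb; have := r0_ t; have := o1_ t; rewrite /refined_norm; lra.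
have sm2 t : mu t != 0 -> shiftvar beta0 (dbl t) <= D%:R^-1 *+ 2.
  by move/sm; have [_ _ /(_ t t)] := sn0; rewrite /dbl; lra.
have E1 := energy_smooth_ge pm pb p0 sm sb0.
have E2 := energy_smooth_ge pm pb p0 sm2 sb0.
have g0 x : 0 <= smooth id beta f0 x.
  by apply: smooth_ge0 => // y; case/andP: (ind01 R a y).
have S := ap_form_schur pm g0.
have L := ap_form_smooth_le pb sb1 sb2.
have P := ap_form_popular pm mK c0 apc.
have KD : (2 * index_bound A D)%:R <= N / D%:R.
  by rewrite ler_pdivlMr // -natrM ler_nat.
(* With y = |G|/D the six energy comparisons lose 4 * 6y + 2 * 9y, and three times the progression
   count loses 3 * (3y + y); division by 3 gives 18y. *)
move: E1 E2 S L P KD; rewrite [N / _]mulrC; set y := D%:R^-1 * N.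
rewrite (_ : (D%:R^-1 + D%:R^-1) *+ 3 * N = y *+ 6); last by rewrite /y; ring.
rewrite (_ : (D%:R^-1 *+ 2 + D%:R^-1) *+ 3 * N = y *+ 9); last by rewrite /y; ring.
rewrite (_ : D%:R^-1 *+ 3 * N = y *+ 3); last by rewrite /y; ring.
lra.
Qed.

End EnergyIncrement.

(** * Tower bounds *)

Section Growth.

Lemma cube_le_exp2 n : (12 <= n)%N -> (2 * n ^ 3 <= 2 ^ n)%N.
Proof.
elim: n => // n IH; rewrite leq_eqVlt => /orP[/eqP <- //|]; rewrite ltnS => n12.
have := IH n12; rewrite (expnS 2 n) !expnS expn0 !muln1; set e := (2 ^ n)%N; nia.
Qed.

Lemma expn_le_exp2 x y : (x ^ y <= 2 ^ (x * y))%N.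
Proof.
have [->|y0] := posnP y; first by rewrite muln0.
by rewrite expnM leq_exp2r // ltnW // ltn_expl.
Qed.

Definition iexp k n := iter k (expn 2) n.

Lemma iexp_mono k m n : (m <= n)%N -> (iexp k m <= iexp k n)%N.
Proof. by move=> mn; elim: k => //= k; rewrite leq_exp2l. Qed.

Lemma iexp_ge k n : (n <= iexp k n)%N.
Proof. by elim: k => //= k IH; apply: leq_trans IH _; rewrite ltnW // ltn_expl. Qed.

Lemma tower_iexp k n : tower (k + n) = iexp k (tower n).
Proof. by elim: k => //= k ->. Qed.

Lemma tower_gt n : (n < tower n)%N.
Proof. by elim: n => //= n IH; apply: leq_trans (_ : (tower n).+1 <= _)%N; rewrite // ltn_expl. Qed.

Lemma tower_mono m n : (m <= n)%N -> (tower m <= tower n)%N.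
Proof. by move=> mn; rewrite -(subnK mn) tower_iexp iexp_ge. Qed.

(** (2AD)^A <= 2^(2 A^2 D) <= 2^(2 A^3) <= 2^(2^A). *)
Lemma index_bound_le A D : (16 <= A)%N -> (D <= A)%N -> (index_bound A D <= iexp 3 A)%N.
Proof.
move=> A16 DA; rewrite /index_bound /= leq_exp2l //.
apply: leq_trans (expn_le_exp2 _ _) _; rewrite leq_exp2l //.
have := cube_le_exp2 (leq_trans (isT : 12 <= 16)%N A16).
rewrite !expnS expn0 !muln1; apply: leq_trans; nia.
Qed.

Lemma index_product_le A D : (16 <= A)%N -> (D <= A)%N ->
  (32 * A * index_bound A D * D <= iexp 4 A)%N.
Proof.
move=> A16 DA; have I := index_bound_le A16 DA.
have C : (32 * (A * A) <= iexp 1 A)%N.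
  have := cube_le_exp2 (leq_trans (isT : 12 <= 16)%N A16).
  rewrite /= !expnS expn0 !muln1; apply: leq_trans; nia.
have C2 : (iexp 1 A <= iexp 3 A)%N by rewrite /= leq_exp2l // (iexp_ge 2).
apply: (@leq_trans (iexp 3 A * iexp 3 A)).
  apply: (@leq_trans (32 * (A * A) * index_bound A D)); first nia.
  by apply: leq_mul => //; apply: leq_trans C2.
rewrite [iexp 3 A]/= -expnD addnn -mul2n -expnS [iexp 4 A]/= leq_exp2l //.
by rewrite leq_exp2l // ltn_expl.
Qed.

(** [index_product_le] is used at [A] and again at [refined A D], each time costing four
    exponentials. *)
Lemma next_bound_le A D : (16 <= A)%N -> (D <= A)%N -> (next_bound A D <= iexp 8 A)%N.
Proof.
move=> A16 DA; have r4 := index_product_le A16 DA; rewrite -/(refined A D) in r4.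
rewrite /next_bound; set r := refined A D in r4 *.
have [r0|rp] := posnP r; first by rewrite r0 muln0.
have Ar : (A <= r)%N.
  have [D0|D0] := posnP D; first by move: rp; rewrite /r /refined D0 muln0.
  rewrite /r /refined (_ : 32 * A * index_bound A D * D = A * (32 * (index_bound A D * D)))%N.
    by rewrite leq_pmulr // !muln_gt0 index_bound_gt0.
  by set I := index_bound A D; ring.
apply: (@leq_trans (iexp 4 r)); last first.
  by rewrite -[leqRHS]/(iexp 4 (iexp 4 A)) iexp_mono.
apply: leq_trans (index_product_le (leq_trans A16 Ar) (leq_trans DA Ar)).
by rewrite -!mulnA leq_mul2r orbT.
Qed.

Lemma next_bound_ge A D : (0 < A)%N -> (0 < D)%N ->
  (2 * index_bound A D * D <= next_bound A D)%N /\ (A <= next_bound A D)%N.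
Proof.
move=> A0 D0; rewrite /next_bound.
have r1 : (index_bound A D <= refined A D)%N.
  rewrite /refined; set I := index_bound A D.
  have -> : (32 * A * I * D = I * (32 * (A * D)))%N by ring.
  by rewrite leq_pmulr // !muln_gt0 A0.
have r2 : (A <= refined A D)%N.
  rewrite /refined; have := index_bound_gt0 A D; set I := index_bound A D => I0.
  have : (0 < I * D)%N by rewrite muln_gt0 I0.
  by rewrite -!mulnA; set q := (I * D)%N; nia.
have := index_bound_gt0 (refined A D) D; set I := index_bound (refined A D) D => I0.
have ID : (0 < I * D)%N by rewrite muln_gt0 I0.
split; last apply: leq_trans r2 _; move: r1; set r := refined A D => r1.
  rewrite leq_mul2r; apply/orP; right; rewrite -mulnA leq_mul2l /=.
  by apply: leq_trans r1 _; rewrite leq_pmulr.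
have -> : (2 * r * I * D = r * (2 * (I * D)))%N by ring.
by rewrite leq_pmulr // muln_gt0.
Qed.

End Growth.

(** * The uniform measure on an interval *)

Section Interval.
Variables (R : realFieldType).

Lemma sum_lt n q : (q <= n)%N -> (\sum_(t < n) (t < q) = q)%N.
Proof.
move=> qn; rewrite (eq_bigr (fun t : 'I_n => if (t < q)%N then 1 else 0)%N); last first.
  by move=> t _; case: ltnP.
by rewrite -big_mkcond -(big_ord_widen n (fun=> 1%N) qn) sum1_card card_ord.
Qed.

Lemma sum_between n lo hi : (\sum_(t < n) ((lo <= t) && (t < hi)) <= hi - lo)%N.
Proof.
suff : (\sum_(t < n) ((lo <= t) && (t < hi)) <= minn n hi - lo)%N by lia.
elim: n => [|n IH]; first by rewrite big_ord0.
rewrite big_ord_recr /=; move: IH; set S := \sum_(_ < n) _; lia.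
Qed.

Lemma sum_fset (n : nat) (B : {fset nat}) : (forall b, b \in B -> (b < n)%N) ->
  (\sum_(x < n) (nat_of_ord x \in B) = #|` B|)%N.
Proof.
move=> Bn; rewrite -(big_mkord predT (fun x => (x \in B) : nat)) /=.
rewrite (eq_bigr (fun x => if x \in B then 1 else 0)%N); last by move=> x _; case: ifP.
rewrite -big_mkcond sum1_count -size_filter; apply/eqP; rewrite eq_sym; apply/eqP.
apply/perm_size/uniq_perm; rewrite ?fset_uniq ?filter_uniq ?iota_uniq // => x.
rewrite mem_filter mem_index_iota /=.
by apply/idP/andP => [xB|[]//]; rewrite xB Bn.
Qed.

Section Uniform.
Variables (p m0 : nat).
Hypotheses (m00 : (0 < m0)%N) (m0p : (m0 <= p.+1)%N).

Definition unif (t : 'I_p.+1) : R := (t < m0)%N%:R / m0%:R.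

Lemma unif_prob : prob unif.
Proof.
split=> [t|]; first by rewrite divr_ge0.
by rewrite -mulr_suml -natr_sum sum_lt // divff // pnatr_eq0 -lt0n.
Qed.

(** At most s points leave the interval at its upper end, and at most s wrap around the modulus. *)
Lemma unif_shiftvar (s : 'I_p.+1) : shiftvar unif s * m0%:R <= (2 * s)%:R.
Proof.
have m0R : 0 < m0%:R :> R by rewrite ltr0n.
rewrite /shiftvar mulr_suml.
apply: (@le_trans _ _ (\sum_(t < p.+1)
   (((m0 - s <= t) && (t < m0)) + ((p.+1 - s <= t) && (t < p.+1)))%N%:R)).
  apply: ler_sum => t _; rewrite /unif -mulrBl normrM normrV ?unitfE ?gt_eqF //.
  rewrite (gtr0_norm m0R) divfK ?gt_eqF //.
  have E : nat_of_ord (t + s) = ((t + s) %% p.+1)%N by [].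
  have tp := ltn_ord t; have sp := ltn_ord s; rewrite E.
  have [ts|ts] := ltnP (t + s) p.+1.
    rewrite modn_small //.
    case: (ltnP (t + s) m0) => h1; case: (ltnP t m0) => h2; rewrite ?subrr ?normr0 //.
      by lia.
    rewrite sub0r normrN normr1 ler1n addn_gt0; lia.
  have -> : ((t + s) %% p.+1 = t + s - p.+1)%N.
    by rewrite -{1}(subnK ts) modnDr modn_small //; lia.
  apply: (@le_trans _ _ 1).
    by do 2!case: ltnP => _; rewrite ?subrr ?subr0 ?sub0r ?normr0 ?normrN ?normr1.
  rewrite ler1n addn_gt0; lia.
rewrite -natr_sum ler_nat big_split /= mul2n -addnn leq_add //.
  by apply: leq_trans (sum_between _ _ _) _; lia.
by apply: leq_trans (sum_between _ _ _) _; have := ltn_ord s; lia.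
Qed.

(** Every t <= m0 / (2m) lies in the ball, so the index is linear in m, well within the exponential
    form. *)
Lemma unif_tame K : (0 < K)%N -> (p.+1 <= K * m0)%N -> tame (shiftvar unif) (2 * K).
Proof.
move=> K0 pK m mp; rewrite card_ord.
have m0R : 0 < m0%:R :> R by rewrite ltr0n.
set q := (m0 %/ (2 * m)).+1.
have B : (minn q p.+1 <= #|ball (shiftvar unif) m|)%N.
  rewrite -{1}(@sum_lt p.+1 (minn q p.+1)) ?geq_minr // -sum1_card [leqRHS]big_mkcond.
  apply: leq_sum => t _; case: ltnP => // tq; rewrite inE ifT //.
  have tm : (2 * t * m <= m0)%N.
    have : (t <= m0 %/ (2 * m))%N by move: tq; rewrite /q; lia.
    by rewrite leq_divRL ?muln_gt0 //; lia.
  rewrite -(ler_pM2r m0R) mul1r mulrAC.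
  apply: le_trans (_ : (2 * t * m)%:R <= _); last by rewrite ler_nat.
  by rewrite natrM ler_wpM2r // unif_shiftvar.
have qm : (m0 < q * (2 * m))%N by rewrite /q ltn_ceil // muln_gt0.
apply: leq_trans (_ : minn q p.+1 * (2 * K * m) <= _)%N.
  have [] := leqP q p.+1 => _; last nia.
  apply: leq_trans pK _; rewrite (_ : q * (2 * K * m) = K * (q * (2 * m)))%N.
    by rewrite leq_mul2l (ltnW qm) orbT.
  by ring.
apply: leq_mul => //; apply: leq_trans (_ : (2 * K * m) ^ (2 * K) <= _)%N.
  by rewrite -[X in (X <= _)%N]expn1 leq_pexp2l //; nia.
by rewrite ltnW // ltn_expl.
Qed.

End Uniform.
End Interval.

(** * Progressions of integers *)

Section Roth.
Variables (R : realFieldType) (k : nat) (A : {fset nat}).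

(* [N = k + 1]; the modulus [2 N + 1] is odd and large enough that a 3-term progression
   modulo it with terms in [1, N] is a progression of integers. *)
Let N := k.+1.
Let p := (k.*2).+2.
Let G : finZmodType := 'I_p.+1.
Hypothesis AN : forall x, x \in A -> (1 <= x <= N)%N.

Definition residues : pred G := fun x => nat_of_ord x \in A.
Let f0 : G -> R := ind R residues.
Let al : R := (#|` A|)%:R / N%:R.

Let pE : p.+1 = (2 * N).+1. Proof. by rewrite /p /N; lia. Qed.

(** The modulus is 2k + 3, so k + 2 is the inverse of 2. *)
Definition halve (x : G) : G := x *+ k.+2.

Lemma Zp_mulrp (x : G) : x *+ p.+1 = 0.
Proof. by rewrite Zp_mulrn; apply: val_inj; rewrite /= modnMl. Qed.

Lemma dblK : cancel (@dbl G) halve.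
Proof.
move=> x; rewrite /halve /dbl -mulr2n -mulrnA.
by rewrite (_ : 2 * k.+2 = p.+1 + 1)%N ?mulrnDr ?Zp_mulrp ?add0r // /p; lia.
Qed.

Lemma halfK : cancel halve (@dbl G).
Proof.
move=> x; rewrite /halve /dbl -mulrnDr.
by rewrite (_ : k.+2 + k.+2 = p.+1 + 1)%N ?mulrnDr ?Zp_mulrp ?add0r // /p; lia.
Qed.

Lemma sum_f0 : \sum_x f0 x = (#|` A|)%:R.
Proof. by rewrite -(@sum_fset p.+1) ?natr_sum // => x /AN; lia. Qed.

Lemma cardA_le : (#|` A| <= N)%N.
Proof.
rewrite -(@sum_fset p.+1); last by move=> x /AN; lia.
apply: leq_trans (_ : \sum_(x < p.+1) ((1 <= x) && (x < N.+1)) <= _)%N.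
  by apply: leq_sum => x _; case xA: (_ \in A) => //; have := AN xA; lia.
by apply: leq_trans (sum_between _ _ _) _; lia.
Qed.

Lemma ap_count_opp (l : G) : ap_count R residues (- l) = ap_count R residues l.
Proof.
rewrite /ap_count -(sum_shift _ (dbl l)); apply: eq_bigr => x _.
have -> : x + dbl l + - l = x + l by rewrite /dbl addrA addrK.
have -> : x + dbl l + dbl (- l) = x by rewrite /dbl -opprD addrK.
by ring.
Qed.

(** No wrap-around: x, l <= N give x + l <= 2N, and x + l in [A] is then at most N, so x + 2l <= 2N
    as well. *)
Lemma ap_count_le (l : G) : (l <= N)%N ->
  ap_count R residues l <= (#|` AP3_starts A l|)%:R.
Proof.
move=> lN; rewrite -(@sum_fset p.+1); last first.
  move=> x; rewrite !inE /= => /andP[/AN]; lia.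
rewrite natr_sum; apply: ler_sum => x _.
have -> : (nat_of_ord x \in AP3_starts A l) =
    [&& nat_of_ord x \in A, x + l \in A & x + 2 * l \in A]%N by rewrite !inE.
rewrite /ind /residues; case xA: (nat_of_ord x \in A); last by rewrite !mul0r.
have /andP[x1 xN] := AN xA; rewrite mul1r.
have E1 : nat_of_ord (x + l) = (x + l)%N by rewrite /= modn_small //; lia.
rewrite E1; case xlA: (x + l \in A)%N; last by rewrite mul0r.
have /andP[_ xlN] := AN xlA; rewrite mul1r.
have -> : nat_of_ord (x + dbl l) = (x + 2 * l)%N.
  have -> : nat_of_ord (x + dbl l) = ((nat_of_ord (x + l)%R + l) %% p.+1)%N.
    by rewrite /dbl addrA.
  by rewrite E1 modn_small; lia.
by [].
Qed.

(** A residue above N is replaced by its negative, which reverses the progressions. *)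
Lemma ap_count_bound (c : R) :
    (forall d, (0 < d <= N)%N -> (#|` AP3_starts A d|)%:R <= c) ->
  forall l : G, l != 0 -> ap_count R residues l <= c.
Proof.
move=> Ac l l0.
have l0' : (0 < l)%N by rewrite lt0n; apply: contra l0 => /eqP l0; apply/eqP/val_inj.
have lp := ltn_ord l.
have [lN|Nl] := leqP l N.
  by apply: le_trans (ap_count_le lN) _; apply: Ac; rewrite l0'.
have E : nat_of_ord (- l) = (p.+1 - l)%N by rewrite /= modn_small //; lia.
rewrite -ap_count_opp; have lN : (nat_of_ord (- l) <= N)%N by rewrite E; lia.
by apply: le_trans (ap_count_le lN) _; apply: Ac; rewrite lN E; lia.
Qed.

(** The smoothed indicator has sum al N and lives on at most N + m0 points, so convexity of the cube
    gives 3 al^3 N - 2 al^3 (N + m0). *)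
Lemma base_energy m0 : (0 < m0)%N -> (m0 <= N)%N ->
  al ^+ 3 * N%:R - (2 * m0)%:R <= energy (smooth id (@unif R p m0) f0).
Proof.
move=> m00 m0N; have N0 : 0 < N%:R :> R by rewrite ltr0n.
have m0p : (m0 <= p.+1)%N by lia.
have pu := @unif_prob R p m0 m00 m0p; set F := smooth id _ f0.
have f01 x : 0 <= f0 x <= 1 by exact: ind01.
have F0 x : 0 <= F x by apply: smooth_ge0 => // y; case/andP: (f01 y).
have al0 : 0 <= al by rewrite divr_ge0.
have al1 : al <= 1 by rewrite ler_pdivrMr // mul1r ler_nat cardA_le.
have alN : al * N%:R = (#|` A|)%:R by rewrite divfK // gt_eqF.
have sumF : \sum_x F x = al * N%:R.
  rewrite alN -sum_f0 /F /smooth exchange_big /= -[RHS](prob_cst pu).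
  by apply: eq_bigr => t _; rewrite -mulr_sumr sum_shift.
(* Smoothing spreads [1, N] downwards by less than m0, hence past 0 to the top residues; N + 1 and
   m0 - 1 points are counted. *)
pose out (x : G) := (((0 <= x) && (x < N.+1)) + ((p.+2 - m0 <= x) && (x < p.+1)))%N.
have supp x : out x = 0%N -> F x = 0.
  have xp := ltn_ord x; rewrite /out xp andbT leq0n /= => /eqP.
  rewrite addn_eq0 !eqb0 -leqNgt -ltnNge => /andP[xN xm].
  apply: big1 => t _; rewrite /unif.
  have [tm|tm] := ltnP t m0; last by rewrite mul0r mul0r.
  have E : nat_of_ord (x + id t) = (x + t)%N.
    by rewrite /= modn_small //; lia.
  rewrite /f0 /ind /residues E (_ : (_ \in A) = false) ?mulr0 //.
  by apply/negP => /AN; lia.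
have outs : (\sum_x out x <= N + m0)%N.
  rewrite /out big_split; apply: (leq_trans (leq_add (sum_between p.+1 0 N.+1)
    (sum_between p.+1 (p.+2 - m0) p.+1))); lia.
(* The tangent line to y^3 at y = al; outside the support of F the cube vanishes. *)
have tangent x : al ^+ 2 * F x *+ 3 - al ^+ 3 *+ 2 * (out x)%:R <= F x ^+ 3.
  case ox: (out x) => [|n].
    by rewrite supp // mulr0 mul0rn mulr0 subr0 expr0n.
  have c0 : 0 <= al ^+ 3 *+ 2 by rewrite mulrn_wge0 // exprn_ge0.
  have n0 : 0 <= n%:R :> R by [].
  have cn : 0 <= al ^+ 3 *+ 2 * n%:R by rewrite mulr_ge0.
  have : 0 <= (F x - al) ^+ 2 * (F x + al *+ 2).
    by rewrite mulr_ge0 ?sqr_ge0 ?addr_ge0 ?mulrn_wge0.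
  have -> : al ^+ 3 *+ 2 * n.+1%:R = al ^+ 3 *+ 2 + al ^+ 3 *+ 2 * n%:R.
    by rewrite -[n.+1]add1n natrD; ring.
  lra.
have : \sum_x (al ^+ 2 * F x *+ 3 - al ^+ 3 *+ 2 * (out x)%:R) <= energy F.
  by apply: ler_sum => x _; exact: tangent.
rewrite sumrB sumrMnl -mulr_sumr sumF -mulr_sumr -natr_sum.
apply: le_trans.
have : al ^+ 3 *+ 2 * (\sum_x out x)%:R <= al ^+ 3 *+ 2 * (N + m0)%:R.
  by rewrite ler_wpM2l ?ler_nat // mulrn_wge0 // exprn_ge0.
have : al ^+ 3 * m0%:R <= m0%:R by rewrite ler_piMl // exprn_ile1.
rewrite natrD natrM mulrDr; lra.
Qed.

(** * Iteration of the stages and contradiction *)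

Definition levels (D i : nat) := iter i (next_bound^~ D) (12 * D)%N.

Lemma levels_gt0 D i : (0 < D)%N -> (0 < levels D i)%N.
Proof.
move=> D0; elim: i => [|i IH]; first by rewrite muln_gt0.
exact: leq_trans IH (next_bound_ge IH D0).2.
Qed.

(* The hypothesis on [D] makes the loss 18 |G| / D of a stage at most eps N / 2. *)
Lemma energy_iteration (eps : R) D s : 0 < eps -> (0 < D)%N -> (levels D s <= N)%N ->
    108 <= D%:R * eps ->
  let c := (al ^+ 3 - eps) * N%:R in
    0 <= c -> (forall d, (0 < d <= N)%N -> (#|` AP3_starts A d|)%:R <= c) ->
  exists beta : G -> R, [/\ prob beta, tame (shiftvar beta) (levels D s) &
    al ^+ 3 * N%:R + (2 ^+ s / 4 - 2^-1) * (eps * N%:R)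
    <= energy (smooth id beta f0)].
Proof.
move=> eps0 D0 + Deps c c0 Ac; have N0 : 0 < N%:R :> R by rewrite ltr0n.
have D0' : 0 < D%:R :> R by rewrite ltr0n.
have ND : N%:R / D%:R * 108 <= eps * N%:R.
  by rewrite -mulrA mulrC ler_wpM2r ?(ltW N0) // mulrC ler_pdivrMr // mulrC.
elim: s => [|s IH] sN.
  have DN : (D <= N)%N by apply: leq_trans sN; rewrite leq_pmull.
  (* The loss 2 m0 is at most eps N / 4, and 2N + 1 <= 6 D m0 explains the starting level 12 D. *)
  pose m0 := (N %/ D)%N.
  have m00 : (0 < m0)%N by rewrite divn_gt0.
  have m0N : (m0 <= N)%N by exact: leq_div.
  have Nm0 : (N < m0.+1 * D)%N by rewrite ltn_ceil.
  exists (@unif R p m0); split; first by apply: unif_prob => //; lia.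
    rewrite /levels /= (_ : 12 * D = 2 * (6 * D))%N; last by lia.
    apply: unif_tame; rewrite ?muln_gt0 ?D0 //; first lia.
    by rewrite pE; move: Nm0; rewrite mulSn; nia.
  apply: le_trans (base_energy m00 m0N).
  have m0D : m0%:R <= N%:R / D%:R :> R.
    by rewrite ler_pdivlMr // -natrM ler_nat leq_trunc_div.
  have := divr_ge0 (ltW N0) (ltW D0'); rewrite natrM expr0 -/al; lra.
have [s1 s2] := next_bound_ge (levels_gt0 s D0) D0.
have [|beta [pb tb eb]] := IH; first exact: leq_trans s2 sN.
have GN : (2 * index_bound (levels D s) D * D <= #|G|)%N.
  rewrite card_ord pE; apply: leq_trans s1 _; apply: leq_trans sN _; lia.
have [gamma [pg tg eg]] := stage dblK halfK pb tb (levels_gt0 s D0) D0 c0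
  (ap_count_bound Ac) GN.
exists gamma; split=> //; apply: le_trans eg.
have GR : #|G|%:R <= N%:R *+ 3 :> R.
  by rewrite card_ord -[leRHS]mulr_natr -natrM ler_nat pE; lia.
have GD : #|G|%:R / D%:R <= N%:R / D%:R *+ 3 :> R.
  rewrite (_ : N%:R / D%:R *+ 3 = N%:R *+ 3 / D%:R :> R); last by ring.
  by apply: ler_wpM2r; rewrite // invr_ge0 ltW.
(* As |G| <= 3N, the coefficient e of eps N becomes at least 2e + 1/2, so e + 1/2 doubles. *)
move: eb; rewrite -/f0; set E := energy _ => eb.
rewrite /c (exprS 2 s) [(al ^+ 3 - eps) * _]mulrBl.
set t := 2 ^+ s in eb *; set y := eps * N%:R in ND eb *; lra.
Qed.

Lemma popular_difference (eps : R) (u : nat) : 0 < eps -> 1 <= 2 ^+ u * eps ->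
    (tower (9 * u + 36) <= N)%N ->
  exists d, (0 < d)%N /\
   (al ^+ 3 - eps) * N%:R <= (#|` AP3_starts A d|)%:R.
Proof.
move=> eps0 ueps towN; have N0 : 0 < N%:R :> R by rewrite ltr0n.
set c := _ * N%:R.
have [c0|/ltW c0] := lerP c 0; first by exists 1%N; split=> //; apply: le_trans c0 _.
have [/existsP[d cd]|] := boolP [exists d : 'I_N, c <= (#|` AP3_starts A d.+1|)%:R].
  by exists d.+1.
rewrite negb_exists => /forallP Ac.
have {}Ac d : (0 < d <= N)%N -> (#|` AP3_starts A d|)%:R <= c.
  case: d => // d dN; have := Ac (Ordinal (dN : (d < N)%N)).
  by rewrite -ltNge => /ltW.
(* 2^7 >= 108 meets the condition on [D]; u + 3 stages bring the excess to at least 2N - eps N /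
   2. *)
pose D := (2 ^ (u + 7))%N; pose s := (u + 3)%N.
have D0 : (0 < D)%N by rewrite expn_gt0.
(* Initially 12 D <= 2^(u + 11) <= tower(u + 12), and each stage adds eight exponentials; 8(u + 3) +
   u + 12 = 9u + 36. *)
have lev i : (16 <= levels D i)%N /\ (D <= levels D i)%N /\
    (levels D i <= iexp (8 * i) (tower (u + 12)))%N.
  elim: i => [|i [IH1 [IH2 IH3]]].
    have D16 : (16 <= D)%N by apply: (@leq_trans (2 ^ 4)); rewrite // leq_exp2l //; lia.
    split; first by rewrite /levels /=; lia.
    split; first by rewrite /levels /= leq_pmull.
    rewrite muln0 /levels /= addnS /=.
    apply: leq_trans (_ : 2 ^ (u + 11) <= _)%N; last first.
      by rewrite leq_exp2l // ltnW // tower_gt.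
    rewrite /D (_ : u + 11 = 4 + (u + 7))%N; last by lia.
    by rewrite (expnD 2 4) leq_mul2r orbT.
  have [_ g2] := next_bound_ge (levels_gt0 i D0) D0.
  split; first exact: leq_trans IH1 g2.
  split; first exact: leq_trans IH2 g2.
  rewrite mulnS; apply: leq_trans (next_bound_le IH1 IH2) _.
  by rewrite /iexp iterD -/(iexp _ _); apply: (@iexp_mono 8).
have levN : (levels D s <= N)%N.
  have [_ [_ h]] := lev s; apply: leq_trans h _; rewrite -tower_iexp.
  by apply: leq_trans towN; apply: tower_mono; rewrite /s; lia.
have Deps : 108 <= D%:R * eps.
  rewrite /D natrX exprD mulrAC; have : (108 : R) <= 2 ^+ 7 by rewrite -natrX ler_nat.
  have := exprn_ge0 7 (ler0n R 2); nra.
have [beta [pb _ E]] := energy_iteration eps0 D0 levN Deps c0 Ac.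
have f01 x : 0 <= f0 x <= 1 by exact: ind01.
have E1 : energy (smooth id beta f0) <= al * N%:R.
  apply: le_trans (energy_smooth id pb _) _ => [x|]; first by case/andP: (f01 x).
  rewrite divfK ?gt_eqF // -sum_f0; apply: ler_sum => x _; have /andP[x0 x1] := f01 x.
  by rewrite exprS ler_piMr // exprn_ile1.
have al0 : 0 <= al by rewrite divr_ge0.
have alN : al * N%:R <= N%:R by rewrite divfK ?gt_eqF // ler_nat cardA_le.
(* Since c >= 0 gives eps N <= al^3 N, the energy would be at least 2N, while it is at most al N <=
   N. *)
exfalso; have : 0 <= al ^+ 3 * N%:R by rewrite mulr_ge0 // exprn_ge0.
move: E E1 c0; rewrite /c /s exprD -/al; set y := al ^+ 3 * N%:R.
have -> : (2 : R) ^+ 3 = 8 by ring.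
rewrite mulrBl -/y; move: ueps; set t := 2 ^+ u => ueps.
have : N%:R <= t * (eps * N%:R) by rewrite mulrA ler_peMl.
rewrite !mulrBl -/y; set z := eps * N%:R; set e := energy _.
have -> : t * 8 / 4 * z = t * z *+ 2 by field.
move: N0 alN; set tz := t * z; lra.
Qed.

End Roth.

(** * Choice of the constant *)

Lemma expR_half_le2 (R : realType) : sequences.expR (2^-1 : R) <= 2.
Proof.
(* exp(-1/2) >= 1 - 1/2. *)
have := expR_ge1Dx (- 2^-1 : R); rewrite expRN.
have e0 := expR_gt0 (2^-1 : R); set e := sequences.expR _ in e0 *.
rewrite -(ler_pM2r e0) mulVf ?gt_eqF //; lra.
Qed.

(** With L = ln(1/eps) and 2L < u <= 2L + 1, exp(L) <= exp(1/2)^u <= 2^u. Since L >= 1/2, also 9u +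
    36 <= 18L + 45 <= 108L, the source of the constant 108. *)
Lemma tower_exponent (R : realType) (eps : R) : 0 < eps -> eps < 1 / 2 ->
  exists u, 1 <= 2 ^+ u * eps /\
    (tower (9 * u + 36) <= rtower (108 * ln (1 / eps)))%N.
Proof.
move=> eps0 eps2; set L := ln (1 / eps).
have expL : sequences.expR L = 1 / eps by rewrite lnK // posrE divr_gt0.
have L2 : 2^-1 <= L.
  rewrite -ler_expR expL; apply: le_trans (expR_half_le2 R) _.
  by rewrite ler_pdivlMr //; lra.
pose u := (Num.truncn (2 * L)).+1; exists u.
have u1 : 2 * L < u%:R by rewrite truncnS_gt.
have u2 : u%:R <= 2 * L + 1.
  by rewrite /u -natr1 lerD2r -truncn_ge_nat //; lra.
split.
  have : sequences.expR L <= 2 ^+ u.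
    apply: (@le_trans _ _ (sequences.expR (2^-1 * u%:R))); first by rewrite ler_expR; lra.
    by rewrite mulrC expRM_natl lerXn2r ?nnegrE ?expR_ge0 // expR_half_le2.
  by rewrite expL ler_pdivrMr.
apply: tower_mono; rewrite truncn_ge_nat; last by lra.
by rewrite natrD natrM; lra.
Qed.

Local Open Scope fset_scope.

Theorem theorem1p3 (R : realType) :
  exists C : R, 0 < C /\
    forall (eps : R) (N : nat),
      0 < eps -> eps < 1 / 2 ->
      (0 < N)%N ->
      (rtower (C * ln (1 / eps)) <= N)%N ->
      forall A : {fset nat},
        (forall a : nat, a \in A -> (1 <= a <= N)%N) ->
        let alpha : R := (#|` A|)%:R / N%:R in
        exists d : nat, (0 < d)%N /\
          (alpha ^+ 3 - eps) * N%:R <= (#|` AP3_starts A d|)%:R.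
Proof.
exists 108; split=> // eps [//|k] eps0 eps2 _ towN A AN alpha.
have [u [u_eps tow]] := tower_exponent eps0 eps2.
exact: (@popular_difference R k A AN eps u eps0 u_eps (leq_trans tow towN)).
Qed.
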